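(* Let $u_h\in V^h_{\mathrm{DG}}$ and $u_H\in V^{\mathrm{off}}$ satisfy $a_{\mathrm{DG}}(u_h,v)=(f,v)$ for all $v\in V^h_{\mathrm{DG}}$ and $a_{\mathrm{DG}}(u_H,v)=(f,v)$ for all $v\in V^{\mathrm{off}}$, respectively. Then $$\|u_h-u_H\|_a^2\le C_{\mathrm{err}}\sum_{i=1}^N\sum_{j=1}^2\|R_{j,i}\|^2\big(\lambda^{(i)}_{j,l_{j,i}+1}\big)^{-1},$$ where $C_{\mathrm{err}}>0$ is a uniform constant (depending only on $\gamma$ and $C_{\mathrm{inv}}$).
   Context: **Meshes and coefficient.** $D$ is a (two-dimensional polygonal) domain, $f\in L^2(D)$, $(f,v)=\int_D fv$, and $\kappa:D\to\mathbb{R}$ is a bounded coefficient with $\kappa\ge 1$. $\mathcal{T}^H=\{K_1,\dots,K_N\}$ is a coarse mesh of $D$ of mesh size $H$ (its elements are called coarse blocks), $\mathcal{E}^H$ is the set of all coarse edges (interior and boundary), and $\mathcal{T}^h$ is a fine triangulation of mesh size $h$ that is a conforming refinement of $\mathcal{T}^H$. **Spaces.** For a coarse block $K$, $V_h(K)$ is the conforming piecewise linear finite element space on $K$ with respect to the fine grid, $V_h^0(K)$ its subspace of functions vanishing on $\partial K$, and $V_h(\partial K)$ the space of restrictions of $V_h(K)$ to $\partial K$. $V^h_{\mathrm{DG}}=\{v\in L^2(D): v|_K\in V_h(K)\ \forall K\in\mathcal{T}^H\}$. For $v\in V_h(\partial K)$, its harmonic extension $\widehat v\in V_h(K)$ is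 defined by $\widehat v=v$ on $\partial K$ and $\int_K\kappa\nabla\widehat v\cdot\nabla w=0$ for all $w\in V_h^0(K)$. **Coefficients on edges.** $\kappa_K$ is the maximum of $\kappa$ over $K$. For an interior coarse edge $E$ shared by $K^+,K^-$, $\overline\kappa=(\kappa_{K^+}+\kappa_{K^-})/2$ on $E$; for $E\subset\partial D$ an edge of $K$, $\overline\kappa=\kappa_K$. For a block $K_i$, $\widetilde\kappa$ (depending on $i$) is the maximum of $\overline\kappa$ over all coarse edges $E\subset\partial K_i$. **Averages and jumps.** On an interior edge $E$ shared by $K^+,K^-$, with fixed unit normal $n_E$ pointing from $K^+$ to $K^-$, $\{G\}=\frac12(G^++G^-)$ and $[G]=G^+-G^-$, with $G^\pm=G|_{K^\pm}$. On a boundary edge, $\{G\}=[G]=G$ and $n_E$ points out of $D$. **Normal flux.** For $u\in V_h(K)$, with outward unit normal $n_{\partial K}$, the flux $\kappa\nabla u\cdot n_{\partial K}$ is understood as the element of $V_h(\partial K)$ defined by $\int_{\partial K}(\kappa\nabla u\cdot n_{\partial K})\,v=\int_K\kappa\nabla u\cdot\nabla\widehat v$ for all $v\in V_h(\partial K)$. On an edge $E\subset\partial K$, $\kappa\nabla u\cdot n_E$ (from the side of $K$) is the restriction to $E$ of $\pm\kappa\nabla u\cdot n_{\partial K}$, with sign $+$ if $n_E=n_{\partial K}$ and $-$ if $n_E=-n_{\partial K}$. **Forms and norms.** $a_H(u,v)=\sum_{K\in\mathcal{T}^H}a_H^K(u,v)$ with $a_H^K(u,v)=\int_K\kappa\nabla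 u\cdot\nabla v$, and for a penalty parameter $\gamma>0$ $$a_{\mathrm{DG}}(u,v)=a_H(u,v)-\sum_{E\in\mathcal{E}^H}\int_E\big(\{\kappa\nabla u\cdot n_E\}[v]+\{\kappa\nabla v\cdot n_E\}[u]\big)+\sum_{E\in\mathcal{E}^H}\frac{\gamma}{h}\int_E\overline\kappa[u][v].$$ $C_{\mathrm{inv}}>0$ is a constant such that for every coarse block $K$ and every $v\in V_h(\partial K)$, $a_H^K(\widehat v,\widehat v)\le\kappa_K C_{\mathrm{inv}}^2h^{-1}\int_{\partial K}|v|^2$. It is assumed that $\gamma>C_{\mathrm{inv}}^2$. The energy norm is $\|u\|_a^2=a_{\mathrm{DG}}(u,u)$. **Snapshot and offline spaces.** For each $i$, $V_1^{i,\mathrm{snap}}\subset V_h(K_i)$ is the space of all harmonic extensions $\widehat v$, $v\in V_h(\partial K_i)$, and $V_2^{i,\mathrm{snap}}=V_h^0(K_i)$. Let $(\phi^{(i)}_k,\lambda^{(i)}_{1,k})$ be the eigenpairs, $\phi_k^{(i)}\in V_1^{i,\mathrm{snap}}$, of $$\int_{K_i}\kappa\nabla\phi^{(i)}_k\cdot\nabla v=\frac{\lambda^{(i)}_{1,k}}{H}\int_{\partial K_i}\widetilde\kappa\,\phi^{(i)}_kv\quad\forall v\in V_1^{i,\mathrm{snap}},\qquad \lambda^{(i)}_{1,1}<\lambda^{(i)}_{1,2}<\cdots,$$ and $(\xi^{(i)}_k,\lambda^{(i)}_{2,k})$ the eigenpairs, $\xi_k^{(i)}\in V_2^{i,\mathrm{snap}}$,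 of $$\int_{K_i}\kappa\nabla\xi^{(i)}_k\cdot\nabla v=\frac{\lambda^{(i)}_{2,k}}{H^2}\int_{K_i}\kappa\,\xi^{(i)}_kv\quad\forall v\in V_2^{i,\mathrm{snap}},\qquad \lambda^{(i)}_{2,1}<\lambda^{(i)}_{2,2}<\cdots.$$ (The strict ordering is an assumption.) Given numbers $l_{1,i},l_{2,i}$, set $V_1^{i,\mathrm{off}}=\mathrm{span}\{\phi^{(i)}_l:1\le l\le l_{1,i}\}$ and $V_2^{i,\mathrm{off}}=\mathrm{span}\{\xi^{(i)}_l:1\le l\le l_{2,i}\}$. $V^{\mathrm{off}}$ is the set of all $v$ with $v|_{K_i}\in V_1^{i,\mathrm{off}}+V_2^{i,\mathrm{off}}$ for every $i$. The numbers $l_{j,i}$ are such that $\lambda^{(i)}_{j,l_{j,i}+1}$ exists and is positive (in particular $l_{1,i}\ge1$). **Residuals.** For $j=1,2$ and $v\in V_j^{i,\mathrm{snap}}$ (extended by zero outside $K_i$), $R_{j,i}(v)=\int_{K_i}fv-a_{\mathrm{DG}}(u_H,v)$. Put $\|v\|_{V_1(K_i)}^2=H^{-1}\int_{\partial K_i}\widetilde\kappa v^2$ on $V_1^{i,\mathrm{snap}}$, $\|v\|_{V_2(K_i)}^2=H^{-2}\int_{K_i}\kappa v^2$ on $V_2^{i,\mathrm{snap}}$, and $\|R_{j,i}\|=\sup_{v\in V_j^{i,\mathrm{snap}},\,v\neq0}|R_{j,i}(v)|/\|v\|_{V_j(K_i)}$. *)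

(* Defs.v *)
From HB Require Import structures.
From mathcomp Require Import all_boot all_order all_algebra.
From mathcomp Require Import all_classical all_reals all_analysis.
Set Implicit Arguments.
Unset Strict Implicit.
Unset Printing Implicit Defensive.
Import Order.TTheory GRing.Theory Num.Theory numFieldNormedType.Exports.
Local Open Scope classical_set_scope.
Local Open Scope ring_scope.

(* [R * R] carries the sup norm in the library, hence this one. *)
Definition edist (R : realType) (x y : R * R) : R :=
  Num.sqrt ((x.1 - y.1) ^+ 2 + (x.2 - y.2) ^+ 2).

Definition diam (R : realType) (S : set (R * R)) : R :=
  sup [set r | exists x y, [/\ S x, S y & r = edist x y]].

Definition segment (R : realType) (p q : R * R) : set (R * R) :=
  [set (1 - t) *: p + t *: q | t in `[0, 1]].

Definition affine_on (R : realType) (S : set (R * R)) (v : R * R -> R) : Prop :=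
  exists a b c : R, forall x, S x -> v x = a + b * x.1 + c * x.2.

(* A fine triangle is given by its set of three vertices, a fine edge by its
   two vertices in increasing order, a coarse block by the fine triangles it is
   made of and a coarse edge by the fine edges it is made of.  The normal of
   the coarse edge [E] points from [K^+ = kplus E] to [K^-], where
   [kminus E = Some K^-]; if [E] lies on the boundary of the domain,
   [kminus E = None] and [kplus E] is its only block. *)
Record mesh (R : realType) := Mesh {
  nvert : nat;
  vert : 'I_nvert -> R * R;
  tri : {set {set 'I_nvert}};
  nblk : nat;
  blk : 'I_nblk -> {set {set 'I_nvert}};
  nedge : nat;
  cedge : 'I_nedge -> {set ('I_nvert * 'I_nvert)};
  kplus : 'I_nedge -> 'I_nblk;
  kminus : 'I_nedge -> option 'I_nblk }.

Section Geometry.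
Context (R : realType) (M : mesh R).

Definition hull (A : {set 'I_(nvert M)}) : set (R * R) :=
  [set x | exists w : 'I_(nvert M) -> R,
     [/\ forall p, 0 <= w p, forall p, p \notin A -> w p = 0,
         \sum_p w p = 1 & x = \sum_p w p *: vert p]].

Definition affinely_independent (A : {set 'I_(nvert M)}) : Prop :=
  forall w : 'I_(nvert M) -> R, (forall p, p \notin A -> w p = 0) ->
    \sum_p w p = 0 -> \sum_p w p *: vert p = 0 -> forall p, w p = 0.

Definition domain : set (R * R) :=
  (\bigcup_(A in [set` tri M]) hull A)°.

Definition block (i : 'I_(nblk M)) : set (R * R) :=
  \bigcup_(A in [set` blk i]) hull A.

Definition fine_seg (e : 'I_(nvert M) * 'I_(nvert M)) : set (R * R) :=
  segment (vert e.1) (vert e.2).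

(* The boundary of a union of fine triangles consists of the fine edges that
   belong to exactly one of them. *)
Definition bedges (S : {set {set 'I_(nvert M)}}) :
    {set ('I_(nvert M) * 'I_(nvert M))} :=
  [set e : 'I_(nvert M) * 'I_(nvert M) | (e.1 < e.2)%N &&
     (#|[set A in S | (e.1 \in A) && (e.2 \in A)]| == 1%N)]%SET.

Definition bd (i : 'I_(nblk M)) : set (R * R) :=
  \bigcup_(e in [set` bedges (blk i)]) fine_seg e.

Definition edge_of (E : 'I_(nedge M)) (i : 'I_(nblk M)) : bool :=
  (kplus E == i) || (kminus E == Some i).

Definition coarse_size : R := \big[Num.max/0]_(i < nblk M) diam (block i).

Definition fine_size : R := \big[Num.max/0]_(A in tri M) diam (hull A).

Record is_mesh : Prop := IsMesh {
  tri_card : forall A, A \in tri M -> #|A| = 3;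
  tri_nondegenerate : forall A, A \in tri M -> affinely_independent A;
  tri_conforming : forall A B, A \in tri M -> B \in tri M ->
    hull A `&` hull B = hull (A :&: B)%SET;
  domain_connected : connected domain;
  blk_neq0 : forall i : 'I_(nblk M), exists A, A \in blk i;
  blk_cover : (\bigcup_(i < nblk M) blk i)%SET = tri M;
  blk_disjoint : forall i j : 'I_(nblk M), i != j -> (blk i :&: blk j = finset.set0)%SET;
  blk_connected : forall i : 'I_(nblk M), connected (block i)°;
  cedge_cover :
    (\bigcup_(E < nedge M) cedge E)%SET =
      (\bigcup_(i < nblk M) bedges (blk i))%SET;
  cedge_disjoint : forall E F : 'I_(nedge M), E != F ->
    (cedge E :&: cedge F = finset.set0)%SET;
  cedge_segment : forall E : 'I_(nedge M), exists p q : R * R, p != q /\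
    \bigcup_(e in [set` cedge E]) fine_seg e = segment p q;
  kminus_neq : forall E : 'I_(nedge M), kminus E != Some (kplus E);
  cedge_sides : forall (E : 'I_(nedge M)) e, e \in cedge E ->
    forall i, (e \in bedges (blk i)) = edge_of E i;
  cedge_boundary : forall (E : 'I_(nedge M)) e, e \in cedge E ->
    (e \in bedges (tri M)) = (kminus E == None) }.

End Geometry.

Section Integrals.
Context (R : realType) (M : mesh R).

(* Fine edges are negligible; leaving them out makes the gradient of a
   piecewise linear function defined wherever it is integrated. *)
Definition int_block (i : 'I_(nblk M)) (g : R * R -> R) : R :=
  \sum_(A in blk i)
    \int[(lebesgue_measure \x lebesgue_measure)%E]_(x in (hull A)°) g x.

Definition int_fine_edge (e : 'I_(nvert M) * 'I_(nvert M)) (g : R * R -> R) : R :=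
  edist (vert e.1) (vert e.2) *
  \int[lebesgue_measure]_(t in `[0%R, 1%R])
    g ((1 - t) *: vert e.1 + t *: vert e.2).

Definition int_bd (i : 'I_(nblk M)) (g : R * R -> R) : R :=
  \sum_(e in bedges (blk i)) int_fine_edge e g.

Definition int_edge (E : 'I_(nedge M)) (g : R * R -> R) : R :=
  \sum_(e in cedge E) int_fine_edge e g.

End Integrals.

Section Spaces.
Context (R : realType) (M : mesh R).

Definition Vh (i : 'I_(nblk M)) : set (R * R -> R) :=
  [set v | {within block i, continuous v} /\
           forall A, A \in blk i -> affine_on (hull A) v].

Definition Vh0 (i : 'I_(nblk M)) : set (R * R -> R) :=
  [set v | Vh i v /\ forall x, bd i x -> v x = 0].

Definition Vhb (i : 'I_(nblk M)) : set (R * R -> R) :=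
  [set v | exists2 w, Vh i w & forall x, bd i x -> v x = w x].

(* A function on the broken space is the family of its restrictions to the
   coarse blocks; the i-th member only matters on [block i]. *)
Definition dgfun := 'I_(nblk M) -> R * R -> R.

Definition VDG : set dgfun := [set u | forall i, Vh i (u i)].

Definition ext0 (i : 'I_(nblk M)) (v : R * R -> R) : dgfun :=
  fun j => if j == i then v else fun=> 0.

Definition nonzero_on (i : 'I_(nblk M)) (v : R * R -> R) : Prop :=
  exists2 x, block i x & v x != 0.

Definition span_on (i : 'I_(nblk M)) (n : nat) (g : nat -> R * R -> R) :
    set (R * R -> R) :=
  [set v | exists c : nat -> R,
     forall x, block i x -> v x = \sum_(k < n) c k * g k x].

End Spaces.

Definition dot_grad (R : realType) (u v : R * R -> R) (x : R * R) : R :=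
  'D_((1, 0) : R * R) u x * 'D_((1, 0) : R * R) v x +
  'D_((0, 1) : R * R) u x * 'D_((0, 1) : R * R) v x.

Section Forms.
Context (R : realType) (M : mesh R) (kappa : R * R -> R).
Local Notation H := (coarse_size M).
Local Notation h := (fine_size M).

Definition aK (i : 'I_(nblk M)) (u v : R * R -> R) : R :=
  int_block i (fun x => kappa x * dot_grad u v x).

(* [kappa] is only given on the (open) domain. *)
Definition kappaK (i : 'I_(nblk M)) : R :=
  sup [set kappa x | x in block i `&` @domain R M].

Definition kappa_bar (E : 'I_(nedge M)) : R :=
  if kminus E is Some j then (kappaK (kplus E) + kappaK j) / 2
  else kappaK (kplus E).

Definition kappa_tilde (i : 'I_(nblk M)) : R :=
  \big[Num.max/0]_(E < nedge M | edge_of E i) kappa_bar E.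

Definition is_harmonic_ext (i : 'I_(nblk M)) (v w : R * R -> R) : Prop :=
  [/\ Vh i w, forall x, bd i x -> w x = v x &
      forall z, Vh0 i z -> aK i w z = 0].

Definition is_flux (i : 'I_(nblk M)) (u q : R * R -> R) : Prop :=
  Vhb i q /\ forall v w, Vhb i v -> is_harmonic_ext i v w ->
    int_bd i (fun x => q x * v x) = aK i u w.

(* The flux along the outward normal; [is_flux] determines it on [bd i]. *)
Definition flux (i : 'I_(nblk M)) (u : R * R -> R) : R * R -> R :=
  xget (fun=> 0) (is_flux i u).

Definition avg (E : 'I_(nedge M)) (G : dgfun M) (x : R * R) : R :=
  if kminus E is Some j then (G (kplus E) x + G j x) / 2 else G (kplus E) x.

Definition jump (E : 'I_(nedge M)) (G : dgfun M) (x : R * R) : R :=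
  if kminus E is Some j then G (kplus E) x - G j x else G (kplus E) x.

(* The flux along n_E, which is outward for [kplus E] and inward for the
   other block. *)
Definition edge_flux (E : 'I_(nedge M)) (u : dgfun M) : dgfun M :=
  fun i x => if i == kplus E then flux i (u i) x else - flux i (u i) x.

Definition aH (u v : dgfun M) : R := \sum_i aK i (u i) (v i).

Definition aDG (gamma : R) (u v : dgfun M) : R :=
  aH u v
  - \sum_(E < nedge M) int_edge E (fun x =>
      avg E (edge_flux E u) x * jump E v x
      + avg E (edge_flux E v) x * jump E u x)
  + \sum_(E < nedge M) gamma / h *
      int_edge E (fun x => kappa_bar E * jump E u x * jump E v x).

Definition energy_norm (gamma : R) (u : dgfun M) : R := Num.sqrt (aDG gamma u u).

Definition inverse_inequality (Cinv : R) : Prop :=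
  forall (i : 'I_(nblk M)) v w, Vhb i v -> is_harmonic_ext i v w ->
    aK i w w <= kappaK i * Cinv ^+ 2 * h^-1 * int_bd i (fun x => `|v x| ^+ 2).

Definition V1snap (i : 'I_(nblk M)) : set (R * R -> R) :=
  [set w | exists2 v, Vhb i v & is_harmonic_ext i v w].

Definition V2snap (i : 'I_(nblk M)) : set (R * R -> R) := Vh0 i.

Definition b1 (i : 'I_(nblk M)) (u v : R * R -> R) : R :=
  H^-1 * int_bd i (fun x => kappa_tilde i * u x * v x).

Definition b2 (i : 'I_(nblk M)) (u v : R * R -> R) : R :=
  (H ^+ 2)^-1 * int_block i (fun x => kappa x * u x * v x).

Definition is_eigenpair (i : 'I_(nblk M)) (S : set (R * R -> R))
    (b : (R * R -> R) -> (R * R -> R) -> R) (g : R * R -> R) (mu : R) : Prop :=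
  [/\ S g, nonzero_on i g & forall v, S v -> aK i g v = mu * b g v].

(* [(g 0, lambda 0), ..., (g n.-1, lambda n.-1)] are the eigenpairs, up to
   scaling of the eigenfunctions, and the eigenvalues are simple.  Indices
   start at 0, so that lambda_{l+1} is [lambda l]. *)
Record eigenpairs (i : 'I_(nblk M)) (S : set (R * R -> R))
    (b : (R * R -> R) -> (R * R -> R) -> R)
    (n : nat) (g : nat -> R * R -> R) (lambda : nat -> R) : Prop := Eigenpairs {
  eigenpairs_eq : forall k, (k < n)%N -> is_eigenpair i S b (g k) (lambda k);
  eigenpairs_lt : forall k l, (k < l < n)%N -> lambda k < lambda l;
  eigenpairs_all : forall v mu, is_eigenpair i S b v mu ->
    exists k, [/\ (k < n)%N, mu = lambda k &
      exists c : R, forall x, block i x -> v x = c * g k x] }.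

Definition Voff (l1 l2 : 'I_(nblk M) -> nat)
    (phi xi : 'I_(nblk M) -> nat -> R * R -> R) : set (dgfun M) :=
  [set u | forall i, exists v1 v2,
     [/\ span_on i (l1 i) (phi i) v1, span_on i (l2 i) (xi i) v2 &
         forall x, block i x -> u i x = v1 x + v2 x]].

Definition load (f : R * R -> R) (v : dgfun M) : R :=
  \sum_i int_block i (fun x => f x * v i x).

Definition residual (gamma : R) (f : R * R -> R) (uH : dgfun M)
    (i : 'I_(nblk M)) (v : R * R -> R) : R :=
  int_block i (fun x => f x * v x) - aDG gamma uH (ext0 i v).

Definition residual_norm (gamma : R) (f : R * R -> R) (uH : dgfun M)
    (i : 'I_(nblk M)) (S : set (R * R -> R))
    (b : (R * R -> R) -> (R * R -> R) -> R) : R :=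
  sup [set `|residual gamma f uH i v| / Num.sqrt (b v v)
        | v in [set v | S v /\ nonzero_on i v]].

End Forms.

(* Main.v *)
Require Import Defs.
From HB Require Import structures.
From mathcomp Require Import all_boot all_order all_algebra.
From mathcomp Require Import all_classical all_reals all_analysis.
From mathcomp Require Import zify ring lra measurable_realfun.
Import Order.TTheory GRing.Theory Num.Theory numFieldNormedType.Exports.
Local Open Scope classical_set_scope.
Local Open Scope ring_scope.

(** The proof is the residual argument for a coercive Galerkin method.  Write
    [e = uh - uH].

    Coercivity.  The flux of [u] on a block boundary represents the functional
    [v |-> aK u (hext v)], where [hext] is the harmonic extension.  Testing it
    with itself and using the inverse inequality bounds its square norm on the
    boundary by [kappaK * Cinv ^ 2 / h] times the energy of [u]
    ([flux_bound]).  Young's inequality on each coarse edge then absorbs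
    the flux terms in the penalty and a fraction [Cinv ^ 2 / gamma] of the
    energy, so [aDG u u >= (1 - Cinv ^ 2 / gamma) * aH u u]
    ([aDG_coercive]).

    Residual.  On each block [e] is the sum of its harmonic extension and a
    function vanishing on the boundary; the two parts are orthogonal in energy
    and lie in the two snapshot spaces.  Removing from each part its projection
    onto the retained eigenfunctions changes [e] by a member of the offline
    space, where the residual vanishes.  Hence [aDG e e] is the sum of the
    local residuals at the spectral remainders ([residual_sum]), and each of
    these is at most the residual norm times the norm of the remainder
    ([residual_le]).  The square of that norm is at most the energy of the part
    of [e] divided by the first discarded eigenvalue ([spectral_gap]).  Young's
    inequality and coercivity conclude, with the constant
    [1 / (1 - Cinv ^ 2 / gamma)].

    The linear algebra is done for semi-definite forms on spaces of functions
    that are determined on a block by their values at the vertices.  Existence of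
    harmonic extensions, of fluxes and of representatives of residuals is one
    solvability statement ([riesz]).  The eigenvalue estimate is variational:
    the minimum of the Rayleigh quotient over the complement of the retained
    eigenfunctions is an eigenvalue ([rayleigh]), thus a listed one. *)

(** * Forms on finite-dimensional function spaces *)

Section FunctionSpaces.
Set Implicit Arguments.
Unset Strict Implicit.
Context (R : realType) (T : Type) (K : set T).
Implicit Types (S W : set (T -> R)) (u v w z : T -> R)
  (a b : (T -> R) -> (T -> R) -> R).

Definition lcomb (k : R) u v : T -> R := fun x => k * u x + v x.

Definition sumf n (c : 'I_n -> R) (g : 'I_n -> T -> R) : T -> R :=
  fun x => \sum_(k < n) c k * g k x.

Definition subspace_of S : Prop :=
  S (fun=> 0) /\ forall k u v, S u -> S v -> S (lcomb k u v).

Definition linear_on S (F : (T -> R) -> R) : Prop :=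
  forall k u v, S u -> S v -> F (lcomb k u v) = k * F u + F v.

Definition vanishes v : Prop := forall x, K x -> v x = 0.

(** Finite dimension through nodal values: the values at finitely many nodes
    of [K], here the mesh vertices, determine a function of the space on [K].
    No basis of hat functions has to be constructed. *)
Definition findim S : Prop :=
  exists n (p : 'I_n -> T), (forall i, K (p i)) /\
    forall u, S u -> (forall i, u (p i) = 0) -> vanishes u.

(** The last clause makes the form depend on the values on [K] only; functions
    that agree on [K] represent the same element of the space. *)
Record semi_inner S b : Prop := SemiInner {
  si_lin : forall u, S u -> linear_on S (b u);
  si_sym : forall u v, S u -> S v -> b u v = b v u;
  si_ge0 : forall u, S u -> 0 <= b u u;
  si_null : forall u v, S u -> S v -> vanishes u -> b u v = 0 }.

Lemma lcomb10 : lcomb 1 (fun=> 0) (fun=> 0) = (fun=> 0).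
Proof. by apply/funext => x; rewrite /lcomb mulr0 addr0. Qed.

Lemma linear_on0 S F : subspace_of S -> linear_on S F -> F (fun=> 0) = 0.
Proof.
move=> [S0 _] lF; have := lF 1 _ _ S0 S0; rewrite lcomb10 mul1r => e.
by apply: (addrI (F (fun=> 0))); rewrite addr0 -e.
Qed.

Lemma sumfS n (c : 'I_n.+1 -> R) (g : 'I_n.+1 -> T -> R) :
  sumf c g = lcomb (c ord0) (g ord0)
    (sumf (fun k => c (lift ord0 k)) (fun k => g (lift ord0 k))).
Proof. by apply/funext => x; rewrite /sumf big_ord_recl. Qed.

Lemma sumf0 (c : 'I_0 -> R) (g : 'I_0 -> T -> R) : sumf c g = (fun=> 0).
Proof. by apply/funext => x; rewrite /sumf big_ord0. Qed.

Lemma subspace_sumf S n (c : 'I_n -> R) (g : 'I_n -> T -> R) :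
  subspace_of S -> (forall k, S (g k)) -> S (sumf c g).
Proof.
move=> [S0 SD]; elim: n c g => [|n IH] c g Sg; first by rewrite sumf0.
by rewrite sumfS; apply: SD => //; apply: IH.
Qed.

Lemma linear_sumf S F n (c : 'I_n -> R) (g : 'I_n -> T -> R) :
  subspace_of S -> linear_on S F -> (forall k, S (g k)) ->
  F (sumf c g) = \sum_(k < n) c k * F (g k).
Proof.
move=> sS lF; elim: n c g => [|n IH] c g Sg.
  by rewrite sumf0 big_ord0; apply: linear_on0 lF.
rewrite sumfS lF ?big_ord_recl ?IH //.
exact: subspace_sumf.
Qed.

Lemma linear_sub S F u v : linear_on S F -> subspace_of S -> S u -> S v ->
  F (fun x => u x - v x) = F u - F v.
Proof.
move=> lF sS Su Sv.
have -> : (fun x => u x - v x) = lcomb (-1) v u.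
  by apply/funext => x; rewrite /lcomb mulN1r addrC.
by rewrite lF // mulN1r addrC.
Qed.

Lemma subspace_sub S u v : subspace_of S -> S u -> S v ->
  S (fun x => u x - v x).
Proof.
move=> [_ sD] Su Sv.
have -> : (fun x => u x - v x) = lcomb (-1) v u.
  by apply/funext => x; rewrite /lcomb mulN1r addrC.
exact: sD.
Qed.

Lemma subspace_add S u v : subspace_of S -> S u -> S v ->
  S (fun x => u x + v x).
Proof.
move=> [_ sD] Su Sv.
have -> : (fun x => u x + v x) = lcomb 1 u v.
  by apply/funext => x; rewrite /lcomb mul1r.
exact: sD.
Qed.

Lemma linear_add S F u v : linear_on S F -> subspace_of S -> S u -> S v ->
  F (fun x => u x + v x) = F u + F v.
Proof.
move=> lF sS Su Sv.
have -> : (fun x => u x + v x) = lcomb 1 u v.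
  by apply/funext => x; rewrite /lcomb mul1r.
by rewrite lF // mul1r.
Qed.

Lemma linear_onW S W F : W `<=` S -> linear_on S F -> linear_on W F.
Proof. by move=> WS lF k u v Wu Wv; apply: lF; apply: WS. Qed.

Lemma semi_innerW S W b : W `<=` S -> semi_inner S b -> semi_inner W b.
Proof.
move=> WS [l s p n]; split.
- by move=> u Wu; apply: linear_onW (l _ _) => //; apply: WS.
- by move=> u v Wu Wv; apply: s; apply: WS.
- by move=> u Wu; apply: p; apply: WS.
- by move=> u v Wu Wv; apply: n; apply: WS.
Qed.

Lemma findimW S W : W `<=` S -> findim S -> findim W.
Proof. by move=> WS [n [p [Kp h]]]; exists n, p; split=> // u /WS; apply: h. Qed.

Lemma si_linl S b k u v w : subspace_of S -> semi_inner S b ->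
  S u -> S v -> S w -> b (lcomb k u v) w = k * b u w + b v w.
Proof.
move=> sS [l s _ _] Su Sv Sw; rewrite (s _ w) ?l //; last exact: sS.2.
by rewrite (s w u) // (s w v).
Qed.

Lemma semi_inner_square S b k u v : subspace_of S -> semi_inner S b ->
  S u -> S v -> b (lcomb k u v) (lcomb k u v) =
    k ^+ 2 * b u u + 2 * k * b u v + b v v.
Proof.
move=> sS [l s _ _] Su Sv; have Sw : S (lcomb k u v) by apply: sS.2.
rewrite l // (s _ u) // (s _ v) // !l // (s v u) //; ring.
Qed.

Lemma cauchy_schwarz S b u v : subspace_of S -> semi_inner S b ->
  S u -> S v -> b u v ^+ 2 <= b u u * b v v.
Proof.
move=> sS sb Su Sv; have [l s p _] := sb.
have sq t : 0 <= t ^+ 2 * b u u + 2 * t * b u v + b v v.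
  have St : S (lcomb t u v) by apply: sS.2.
  by have := p _ St; rewrite (semi_inner_square _ sS).
have [b0|b0] := eqVneq (b u u) 0.
  rewrite b0 mul0r; have [->|uv0] := eqVneq (b u v) 0; first by rewrite expr0n.
  have := sq (- (b v v + 1) / (2 * b u v)).
  rewrite b0 mulr0 add0r.
  have -> : 2 * (- (b v v + 1) / (2 * b u v)) * b u v = - (b v v + 1) by field.
  lra.
have b1 : 0 < b u u by rewrite lt0r b0 p.
have := sq (- b u v / b u u).
have -> : (- b u v / b u u) ^+ 2 * b u u + 2 * (- b u v / b u u) * b u v + b v v
  = (b u u * b v v - b u v ^+ 2) / b u u by field.
by rewrite pmulr_lge0 ?invr_gt0// subr_ge0.
Qed.

Lemma null_orthogonal S b u v : subspace_of S -> semi_inner S b ->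
  S u -> S v -> b u u = 0 -> b u v = 0.
Proof.
move=> sS sb Su Sv u0; have := cauchy_schwarz sS sb Su Sv.
by rewrite u0 mul0r => h; apply/eqP; rewrite -sqrf_eq0 eq_le h sqr_ge0.
Qed.

(** Functions of the space whose vectors of nodal values span those of the whole
    space generate it up to functions vanishing on [K]; the coefficients
    are linear in the vector of nodal values, hence in the function. *)
Lemma generating S : subspace_of S -> findim S ->
  exists m (g : 'I_m -> T -> R) (c : 'I_m -> (T -> R) -> R),
  [/\ forall k, S (g k), forall k, linear_on S (c k),
      forall k u, vanishes u -> c k u = 0 &
      forall v, S v -> vanishes (fun x => v x - sumf (c^~ v) g x)].
Proof.
move=> sS [n [p [Kp det]]].
pose ev v : 'rV[R]_n := \row_i v (p i).
have evl k u v : ev (lcomb k u v) = k *: ev u + ev v.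
  by apply/rowP => i; rewrite !mxE.
(* A matrix of nodal values of maximal rank exists: as long as some function
   has its nodal values outside the row space, they can be added as a row. *)
have [m [G [hG Gmax]]] : exists m (G : 'M[R]_(m, n)),
    (forall k, exists2 u, S u & row k G = ev u) /\
    forall v, S v -> (ev v <= G)%MS.
  suff H : forall d m (G : 'M[R]_(m, n)),
      (forall k, exists2 u, S u & row k G = ev u) -> (n - \rank G <= d)%N ->
      exists m (G : 'M[R]_(m, n)),
      (forall k, exists2 u, S u & row k G = ev u) /\
      forall v, S v -> (ev v <= G)%MS.
    apply: (H n 0%N 0) => [[]//|]; exact: leq_subr.
  elim=> [|d IH] m G hG rG.
    exists m, G; split=> // v _.
    apply: submx_full; rewrite /row_full eqn_leq rank_leq_col/=.
    by rewrite -subn_eq0 -leqn0.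
  have [Gmax|/existsNP[v /not_implyP[Sv vG]]] :=
      pselect (forall v, S v -> (ev v <= G)%MS); first by exists m, G.
  apply: (IH _ (col_mx (ev v) G)).
    move=> k; case: (split_ordP k) => j ->.
      by exists v => //; rewrite rowKu; apply/rowP => i; rewrite !mxE.
    by have [u Su e] := hG j; exists u => //; rewrite rowKd.
  have lt : (\rank G < \rank (col_mx (ev v) G))%N.
    apply: rank_ltmx; rewrite ltmxE -addsmxE addsmxSr/= col_mx_sub.
    by rewrite negb_and; apply/orP; left; apply/negP.
  by move: rG lt (rank_leq_col (col_mx (ev v) G)); lia.
have [|g hg] := @choice _ _ (fun k u => S u /\ row k G = ev u).
  by move=> k; have [u Su e] := hG k; exists u.
exists m, g, (fun k v => (ev v *m pinvmx G) 0 k); split.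
- by move=> k; have [] := hg k.
- by move=> k c u v _ _; rewrite evl mulmxDl -scalemxAl !mxE.
- move=> k u u0; have -> : ev u = 0 by apply/rowP => i; rewrite !mxE u0.
  by rewrite mul0mx mxE.
- move=> v Sv; apply: det.
    by apply: subspace_sub => //; apply: subspace_sumf => // k; have [] := hg k.
  move=> i; have := mulmxKpV (Gmax _ Sv) => /rowP/(_ i).
  rewrite [in RHS]mxE => <-; rewrite mxE /sumf; apply/eqP; rewrite subr_eq0.
  apply/eqP/eq_bigr => k _; congr (_ * _).
  by have [_ /rowP/(_ i)] := hg k; rewrite !mxE.
Qed.

(** The linear system for the coefficients of the representative has a symmetric
    matrix, so it is solvable as soon as the right-hand side annihilates
    the kernel.  The form need not be definite, which allows the lemma to be
    applied before any Poincare or unisolvence argument. *)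
Lemma riesz S b F : subspace_of S -> findim S -> semi_inner S b ->
  linear_on S F ->
  (forall z, S z -> (forall v, S v -> b v z = 0) -> F z = 0) ->
  exists2 q, S q & forall v, S v -> b q v = F v.
Proof.
move=> sS fS sb lF F0; have [l s _ n] := sb.
have [m [g [c [Sg _ _ cg]]]] := generating sS fS.
have Fn z : S z -> vanishes z -> F z = 0.
  by move=> Sz z0; apply: F0 => // v Sv; rewrite s // n.
have gen G v : linear_on S G -> (forall z, S z -> vanishes z -> G z = 0) ->
    S v -> G v = \sum_k c k v * G (g k).
  move=> lG Gn Sv; have Ss := subspace_sumf (c^~ v) sS Sg.
  have := Gn _ (subspace_sub sS Sv Ss) (cg _ Sv).
  rewrite (linear_sub lG) // (linear_sumf _ sS lG) //.
  by move/eqP; rewrite subr_eq0 => /eqP.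
pose B : 'M[R]_m := \matrix_(j, k) b (g j) (g k).
pose f : 'rV[R]_m := \row_k F (g k).
have /submxP[D fD] : (f <= B)%MS.
  rewrite submxE; apply/eqP/rowP => j; rewrite !mxE.
  have Sz := subspace_sumf (fun k => cokermx B k j) sS Sg.
  transitivity (F (sumf (fun k => cokermx B k j) g)).
    rewrite (linear_sumf _ sS lF) //; apply: eq_bigr => k _.
    by rewrite mxE mulrC.
  apply: F0 => // v Sv; rewrite s // (gen (b _)) //; last 2 first.
  - exact: l.
  - by move=> z Sz' z0; rewrite s // n.
  rewrite big1// => k _; rewrite s// (linear_sumf _ sS (l _ (Sg k))) //.
  have /matrixP/(_ k j) := mulmx_coker B.
  rewrite !mxE => e; rewrite [X in _ * X](_ : _ = 0) ?mulr0//.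
  by rewrite -[RHS]e; apply: eq_bigr => i _; rewrite !mxE mulrC.
have Sq := subspace_sumf (fun k => D 0 k) sS Sg.
exists (sumf (fun k => D 0 k) g) => // v Sv.
rewrite (gen _ _ lF) // (gen (b _)) //; last 2 first.
- exact: l.
- by move=> z Sz z0; rewrite s // n.
apply: eq_bigr => k _; congr (_ * _).
move/rowP: fD => /(_ k); rewrite !mxE => ->.
rewrite s // (linear_sumf _ sS (l _ (Sg k))) //.
by apply: eq_bigr => i _; rewrite !mxE s.
Qed.

(** On a finite-dimensional space a definite form bounds every other one: each
    coordinate is bounded in the norm of [Q], since [riesz] represents it. *)
Lemma definite_dominates S Q b : subspace_of S -> findim S ->
  semi_inner S Q -> (forall v, S v -> Q v v = 0 -> vanishes v) ->
  semi_inner S b ->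
  exists2 C, 0 < C & forall v, S v -> b v v <= C * Q v v.
Proof.
move=> sS fS sQ dQ sb.
have [m [g [c [Sg lc c0 cg]]]] := generating sS fS.
have [|r hr] := @choice _ _
    (fun k q => S q /\ forall v, S v -> Q q v = c k v).
  move=> k; have [|r Sr e] := riesz sS fS sQ (lc k).
  - by move=> z Sz z0; apply: c0; apply: dQ => //; apply: z0.
  - by exists r.
have cle k v : S v -> c k v ^+ 2 <= Q (r k) (r k) * Q v v.
  move=> Sv; have [Sr e] := hr k.
  by rewrite -(e v Sv); apply: cauchy_schwarz Sr Sv.
pose t : R := m.+1%:R.
have t0 : 0 < t by rewrite ltr0n.
have B0 k : 0 <= b (g k) (g k) by apply: si_ge0 sb _ _.
pose C := \sum_k b (g k) (g k) * Q (r k) (r k).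
have C0 : 0 <= C.
  by apply: sumr_ge0 => k _; rewrite mulr_ge0 // (si_ge0 sQ) //; have [] := hr k.
exists (1 + t * C); first by rewrite ltr_pwDl // mulr_ge0 // ltW.
move=> v Sv; have Qv := si_ge0 sQ Sv; have bv := si_ge0 sb Sv.
have Ss := subspace_sumf (c^~ v) sS Sg.
have e : b v v = \sum_k c k v * b v (g k).
  have := si_null sb (subspace_sub sS Sv Ss) Sv (cg _ Sv).
  rewrite (si_sym sb) //; last exact: subspace_sub.
  rewrite (linear_sub (si_lin sb Sv)) // (linear_sumf _ sS (si_lin sb Sv)) //.
  by move/eqP; rewrite subr_eq0 => /eqP.
have term k : c k v * b v (g k) <=
    b v v / (2 * t) + t / 2 * (b (g k) (g k) * Q (r k) (r k) * Q v v).
  have Sw : S (lcomb (- (t * c k v)) (g k) v) by apply: sS.2.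
  have := si_ge0 sb Sw; rewrite (semi_inner_square _ sS) //.
  rewrite (si_sym sb (Sg k)) // => h.
  have h2 : t ^+ 2 * c k v ^+ 2 * b (g k) (g k) <=
      t ^+ 2 * (Q (r k) (r k) * Q v v) * b (g k) (g k).
    by rewrite ler_wpM2r // ler_wpM2l ?sqr_ge0 // cle.
  rewrite -(ler_pM2l (_ : 0 < 2 * t)) ?mulr_gt0 //.
  have -> : 2 * t * (b v v / (2 * t) +
      t / 2 * (b (g k) (g k) * Q (r k) (r k) * Q v v)) =
      b v v + t ^+ 2 * (Q (r k) (r k) * Q v v) * b (g k) (g k).
    by field; rewrite gt_eqF.
  by move: h h2; lra.
have : b v v <= \sum_(k < m) (b v v / (2 * t) +
    t / 2 * (b (g k) (g k) * Q (r k) (r k) * Q v v)).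
  by rewrite {1}e; apply: ler_sum => k _; exact: term.
rewrite big_split/= sumr_const card_ord -mulr_sumr -mulr_suml -/C => h.
have h2 : b v v / (2 * t) *+ m <= b v v / 2.
  rewrite -mulr_natr -mulrA ler_wpM2l // invfM -mulrA ler_piMr //.
  by rewrite mulrC ler_pdivrMr // mul1r ler_nat.
have : b v v <= t * C * Q v v by move: (le_trans h (lerD h2 (lexx _))); lra.
by move: Qv; lra.
Qed.

(** The infimum of the Rayleigh quotient is attained.  Otherwise [a - mu b] is
    definite for the infimum [mu], so it dominates a positive multiple of [b]
    by [definite_dominates], and [mu] can be increased.  A null vector
    of [a - mu b] is an eigenvector by Cauchy-Schwarz. *)
Lemma rayleigh S a b v1 : subspace_of S -> findim S ->
  semi_inner S a -> semi_inner S b ->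
  (forall v, S v -> b v v = 0 -> vanishes v) -> S v1 -> ~ vanishes v1 ->
  exists v0 mu, [/\ S v0, ~ vanishes v0,
    forall w, S w -> a v0 w = mu * b v0 w &
    forall w, S w -> mu * b w w <= a w w].
Proof.
move=> sS fS sa sb db Sv1 v1K.
have bpos v : S v -> ~ vanishes v -> 0 < b v v.
  move=> Sv vK; rewrite lt0r (si_ge0 sb) // andbT; apply/eqP => e.
  by apply: vK; apply: db.
pose E := [set a v v / b v v | v in [set v | S v /\ ~ vanishes v]].
have E0 : E (a v1 v1 / b v1 v1) by exists v1.
have lbE : lbound E 0.
  by move=> _ [v [Sv vK] <-]; rewrite divr_ge0 ?(si_ge0 sa) ?(si_ge0 sb).
have hE : has_inf E by split; [exists (a v1 v1 / b v1 v1)|exists 0].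
pose mu := inf E.
have mule w : S w -> mu * b w w <= a w w.
  move=> Sw; have [wK|wK] := pselect (vanishes w).
    by rewrite (si_null sb) // (si_null sa) // mulr0.
  rewrite -ler_pdivlMr ?bpos //; apply: ge_inf; [by exists 0|by exists w].
pose Q u v := a u v - mu * b u v.
have sQ : semi_inner S Q.
  split=> [u Su k v w Sv Sw|u v Su Sv|u Su|u v Su Sv u0]; rewrite /Q.
  - by rewrite (si_lin sa) // (si_lin sb) //; ring.
  - by rewrite (si_sym sa) // (si_sym sb).
  - by rewrite subr_ge0 mule.
  - by rewrite (si_null sa) // (si_null sb) // mulr0 subrr.
have [v0 [Sv0 [Q0 v0K]]] : exists v0, S v0 /\ Q v0 v0 = 0 /\ ~ vanishes v0.
  apply: contrapT => /forallNP H.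
  have [v Sv Q0|C C0 hC] := definite_dominates sS fS sQ _ sb.
    by apply: contrapT => vK; apply: (H v).
  have : mu + C^-1 <= mu.
    apply: lb_le_inf; first by exists (a v1 v1 / b v1 v1).
    move=> _ [v [Sv vK] <-]; have bv := bpos _ Sv vK.
    rewrite ler_pdivlMr // mulrDl -lerBrDl ler_pdivrMl //.
    exact: hC.
  by rewrite gerDl leNgt invr_gt0 C0.
exists v0, mu; split=> // w Sw.
by apply/eqP; rewrite -subr_eq0; apply/eqP; exact: null_orthogonal sS sQ Sv0 Sw Q0.
Qed.

Section SpectralGap.
Context S a b (n : nat) (g : nat -> T -> R) (lam : nat -> R).
Hypotheses (sS : subspace_of S) (fS : findim S).
Hypotheses (sa : semi_inner S a) (sb : semi_inner S b).
Hypothesis null_ba : forall v, S v -> b v v = 0 -> a v v = 0.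
Hypothesis eig : forall k, (k < n)%N -> [/\ S (g k), ~ vanishes (g k) &
  forall v, S v -> a (g k) v = lam k * b (g k) v].
Hypothesis lam_lt : forall k l, (k < l < n)%N -> lam k < lam l.
Hypothesis complete : forall v mu, S v -> ~ vanishes v ->
  (forall w, S w -> a v w = mu * b v w) ->
  exists k, [/\ (k < n)%N, mu = lam k &
    exists c, forall x, K x -> v x = c * g k x].

(** A null vector of [b] that is also null for [a] is an eigenvector for every
    [mu], whereas a complete list contains finitely many eigenvalues. *)
Lemma eigen_definite v : S v -> b v v = 0 -> vanishes v.
Proof.
move=> Sv v0; apply: contrapT => vK.
(* This value exceeds all the listed eigenvalues. *)
have [|k [kn e _]] := complete (mu := 1 + \sum_(k < n) `|lam k|) Sv vK.
  move=> w Sw; rewrite (null_orthogonal sS sb) // mulr0.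
  by rewrite (null_orthogonal sS sa) // null_ba.
have : lam k <= \sum_(k < n) `|lam k|.
  rewrite (bigD1 (Ordinal kn)) //=; apply: le_trans (ler_norm _) _.
  by rewrite lerDl sumr_ge0.
by rewrite -e; lra.
Qed.

Lemma eigen_orthogonal j k : (j < n)%N -> (k < n)%N -> j != k ->
  b (g j) (g k) = 0.
Proof.
move=> jn kn jk; have [Sj _ ej] := eig jn; have [Sk _ ek] := eig kn.
have : (lam j - lam k) * b (g j) (g k) = 0.
  by rewrite mulrBl -ej // (si_sym sb) // -ek // (si_sym sa) // subrr.
move/eqP; rewrite mulf_eq0 subr_eq0 => /orP[/eqP e|/eqP //].
by case: (ltngtP j k) jk => // h _; [have := @lam_lt j k|have := @lam_lt k j];
  rewrite h ?jn ?kn e ltxx => /(_ isT).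
Qed.

(** The remainder of the [b]-orthogonal projection onto the first [l]
    eigenfunctions lies in their [b]-orthogonal complement [W].  The minimum
    of the Rayleigh quotient over [W] is an eigenvalue of the whole space,
    with an eigenfunction in [W], so completeness of the list makes it one of
    the [lam k] with [l <= k].  The projection does not increase the
    [a]-energy because [a] and [b] are diagonalized simultaneously. *)
Lemma spectral_gap l v : (l < n)%N -> S v ->
  exists c : nat -> R,
    S (fun x => v x - \sum_(k < l) c k * g k x) /\
    let r := fun x => v x - \sum_(k < l) c k * g k x in
    lam l * b r r <= a v v.
Proof.
move=> ln.
have Lt (k : 'I_l) : (k < n)%N by apply: ltn_trans (ltn_ord k) ln.
have Sg (k : 'I_l) : S (g k) by have [] := eig (Lt k).
have bg k : (k < n)%N -> 0 < b (g k) (g k).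
  move=> kn; have [Sk gK _] := eig kn.
  rewrite lt0r (si_ge0 sb) // andbT; apply/eqP => e.
  by apply: gK; apply: eigen_definite.
pose W := [set v | S v /\ forall k : 'I_l, b (g k) v = 0].
pose c v k := b (g k) v / b (g k) (g k).
pose P v := sumf (fun k : 'I_l => c v k) (fun k : 'I_l => g k).
have SP u : S (P u) by apply: subspace_sumf.
have Wr u : S u -> W (fun x => u x - P u x).
  move=> Su; split=> [|k]; first exact: subspace_sub.
  rewrite (linear_sub (si_lin sb (Sg k))) // (linear_sumf _ sS (si_lin sb _)) //.
  rewrite (bigD1 k) //= big1 => [|j jk]; last first.
    by rewrite eigen_orthogonal ?mulr0 // eq_sym.
  by rewrite addr0 /c divfK ?subrr // gt_eqF // bg.
have aP u w : S u -> W w -> a (P u) w = 0.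
  move=> Su [Sw w0]; rewrite (si_sym sa) // (linear_sumf _ sS (si_lin sa _)) //.
  rewrite big1 // => k _; have [_ _ e] := eig (Lt k).
  by rewrite (si_sym sa) // e // w0 !mulr0.
have bP u w : S u -> W w -> b (P u) w = 0.
  move=> Su [Sw w0]; rewrite (si_sym sb) // (linear_sumf _ sS (si_lin sb _)) //.
  by rewrite big1 // => k _; rewrite (si_sym sb) // w0 mulr0.
have sW : subspace_of W.
  split=> [|k u w [Su u0] [Sw w0]].
    split=> [|k]; first exact: sS.1.
    exact: linear_on0 sS (si_lin sb (Sg k)).
  split=> [|j]; first exact: sS.2.
  by rewrite (si_lin sb) // u0 w0 mulr0 addr0.
have WS : W `<=` S by move=> u [].
have PE u : u = lcomb 1 (P u) (fun x => u x - P u x).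
  by apply/funext => x; rewrite /lcomb mul1r addrC subrK.
move=> Sv; exists (c v); set r := (fun x => _); have Wr' : W r := Wr _ Sv.
have Sr : S r by apply: WS.
split=> //=.
have ar : a r r <= a v v.
  rewrite [v in leRHS]PE (semi_inner_square _ sS sa) //.
  by rewrite (aP v r Sv Wr') mulr0 addr0 expr1n mul1r lerDr (si_ge0 sa).
apply: le_trans ar.
have [rK|rK] := pselect (vanishes r).
  by rewrite (si_null sb) // mulr0 (si_ge0 sa).
have [|v0 [mu [Wv0 v0K e mule]]] := rayleigh sW (findimW WS fS)
  (semi_innerW WS sa) (semi_innerW WS sb) _ Wr' rK.
  by move=> u /WS; apply: eigen_definite.
have Sv0 := WS _ Wv0.
have [|k [kn muE [d v0E]]] := complete (mu := mu) Sv0 v0K.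
  move=> w Sw; have Wq := Wr _ Sw; have Sq := WS _ Wq.
  rewrite (PE w) (si_lin sa Sv0) // (si_lin sb Sv0) //.
  rewrite (si_sym sa Sv0) // aP // (si_sym sb Sv0 (SP _)) // bP //.
  by rewrite !mulr0 !add0r e.
have kl : (l <= k)%N.
  rewrite leqNgt; apply/negP => kl; apply: v0K => x Kx.
  have [Sk _ _] := eig kn.
  have Sd : S (lcomb d (g k) (fun=> 0)) by apply: sS.2 => //; exact: sS.1.
  have : b (fun y => v0 y - lcomb d (g k) (fun=> 0) y) (g k) = 0.
    apply: (si_null sb) => //; first exact: subspace_sub.
    by move=> y Ky; rewrite v0E // /lcomb addr0 subrr.
  rewrite (si_sym sb) //; last exact: subspace_sub.
  rewrite (linear_sub (si_lin sb Sk)) // (si_lin sb) //; last exact: sS.1.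
  rewrite (linear_on0 sS (si_lin sb Sk)) addr0.
  have [_ /(_ (Ordinal kl)) /= ->] := Wv0; rewrite sub0r => /eqP.
  rewrite oppr_eq0 mulf_eq0 (gt_eqF (bg _ kn)) orbF => /eqP d0.
  by rewrite v0E // d0 mul0r.
apply: le_trans (mule _ Wr'); rewrite muE ler_wpM2r ?(si_ge0 sb) //.
by move: kl; rewrite leq_eqVlt => /orP[/eqP->//|kl]; rewrite ltW // lam_lt // kl.
Qed.

End SpectralGap.
End FunctionSpaces.

(** * Integration over bounded open subsets of the plane *)

Section PlaneMeasure.
Set Implicit Arguments.
Unset Strict Implicit.
Context (R : realType).
Implicit Types (A D : set (R * R)) (g : R * R -> R).

Local Notation mu := ((@lebesgue_measure R \x @lebesgue_measure R)%E).
Local Notation plane := (measurableTypeR R * measurableTypeR R)%type.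

(** An open set is the union of the boxes with rational centres and radii
    [1 / n] that it contains. *)
Lemma plane_open_measurable A : open A -> measurable (A : set plane).
Proof.
move=> oA.
pose B (q : rat * rat * nat) : set plane :=
  ball (ratr q.1.1 : R) q.2.+1%:R^-1 `*` ball (ratr q.1.2 : R) q.2.+1%:R^-1.
pose F q := if `[< B q `<=` A >] then B q else set0.
have -> : (A : set plane) = \bigcup_q F q.
  apply/seteqP; split=> [x Ax|x [q _]]; last first.
    by rewrite /F; case: asboolP => // qA; apply: qA.
  have /nbhs_ballP[e /= e0 eA] : nbhs x A by apply: open_nbhs_nbhs.
  have [n ne] : exists n : nat, n.+1%:R^-1 < e / 2.
    exists (Num.trunc (2 / e)); rewrite invf_plt ?posrE ?divr_gt0 //.
    by rewrite invf_div truncnS_gt.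
  have n0 : 0 < n.+1%:R^-1 :> R by rewrite invr_gt0.
  set r : R := n.+1%:R^-1 in ne n0.
  have rt (y : R) : exists q : rat, ball (ratr q : R) n.+1%:R^-1 y.
    have [|q] := @rat_in_itvoo R (y - n.+1%:R^-1) (y + n.+1%:R^-1).
      by rewrite -/r; move: r n0 {ne} => r; lra.
    rewrite in_itv /= => /andP[h1 h2]; exists q.
    by rewrite -/r /ball/= ltr_distlC; move: h1 h2; rewrite -/r; lra.
  have [q1 h1] := rt x.1; have [q2 h2] := rt x.2.
  exists (q1, q2, n) => //; rewrite /F; case: asboolP => [_|]; first by split.
  case=> y [y1 y2]; apply: eA.
  have tri (a b c : R) : ball b r a -> ball b r c -> ball a e c.
    by rewrite /ball/= !ltr_distlC => /andP[? ?] /andP[? ?]; lra.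
  by split; [apply: tri y1|apply: tri y2].
apply: countable_bigcupT_measurable => [|q]; first exact: countableP.
rewrite /F; case: asboolP => // _.
by apply: measurableX; apply: open_measurable; exact: ball_open.
Qed.

Definition planar_bounded D := exists C : R, forall x, D x -> `|x.1| <= C /\ `|x.2| <= C.

Lemma planar_bounded_finite D : measurable (D : set plane) ->
  planar_bounded D -> (mu D < +oo)%E.
Proof.
move=> mD [C hC].
pose I : set R := [set` `[- C, C]].
have mI : measurable I by exact: measurable_itv.
apply: (@le_lt_trans _ _ (mu (I `*` I))).
  apply: le_measure; rewrite ?inE //; first exact: measurableX.
  by move=> x /hC [h1 h2]; split; rewrite /I /= in_itv/= -ler_norml.
rewrite product_measure1E //=.
have fin : (lebesgue_measure I < +oo)%E.
  by rewrite /I lebesgue_measure_itv/=; case: ifP => _; rewrite // -EFinB ltry.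
apply: (lte_mul_pinfty _ _ fin); first exact: measure_ge0.
by rewrite ge0_fin_numE; [exact: fin|exact: measure_ge0].
Qed.

Definition bounded_measurable D g :=
  measurable_fun D g /\ exists B : R, forall x, D x -> `|g x| <= B.

Lemma bounded_measurable_cst D (k : R) : bounded_measurable D (fun=> k).
Proof. by split; [exact: measurable_cst|exists `|k|]. Qed.

Lemma bounded_measurableD D g1 g2 : bounded_measurable D g1 ->
  bounded_measurable D g2 -> bounded_measurable D (fun x => g1 x + g2 x).
Proof.
move=> [m1 [B1 h1]] [m2 [B2 h2]]; split; first exact: measurable_funD.
exists (B1 + B2) => x Dx; apply: le_trans (ler_normD _ _) _.
by apply: lerD; [exact: h1|exact: h2].
Qed.

Lemma bounded_measurableM D g1 g2 : bounded_measurable D g1 ->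
  bounded_measurable D g2 -> bounded_measurable D (fun x => g1 x * g2 x).
Proof.
move=> [m1 [B1 h1]] [m2 [B2 h2]]; split; first exact: measurable_funM.
exists (B1 * B2) => x Dx; rewrite normrM.
by apply: ler_pM => //; [exact: h1|exact: h2].
Qed.

Lemma bounded_measurable_eq D g1 g2 : (forall x, D x -> g1 x = g2 x) ->
  bounded_measurable D g1 -> bounded_measurable D g2.
Proof.
move=> e [m1 [B h]]; split; last by exists B => x Dx; rewrite -e // h.
by apply: eq_measurable_fun m1 => x /set_mem; exact: e.
Qed.

Lemma bounded_measurable_affine D v : planar_bounded D -> affine_on D v ->
  bounded_measurable D v.
Proof.
move=> [C hC] [a [b [c e]]].
apply: (@bounded_measurable_eq D (fun x => a + b * x.1 + c * x.2)).
  by move=> x Dx; rewrite e.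
have b1 : bounded_measurable D (fun x => x.1).
  split; last by exists C => x /hC [].
  by apply: measurable_funTS; exact: measurable_fst.
have b2 : bounded_measurable D (fun x => x.2).
  split; last by exists C => x /hC [].
  by apply: measurable_funTS; exact: measurable_snd.
apply: bounded_measurableD; first apply: bounded_measurableD.
- exact: bounded_measurable_cst.
- by apply: bounded_measurableM => //; exact: bounded_measurable_cst.
- by apply: bounded_measurableM => //; exact: bounded_measurable_cst.
Qed.

Lemma bounded_measurable_bounded D g : bounded_measurable D g ->
  [bounded g x | x in D].
Proof.
move=> [_ [B h]]; exists B; split; first exact: num_real.
by move=> y By x Dx; apply: le_trans (h _ Dx) (ltW By).
Qed.

Lemma bounded_measurable_integrable D g : measurable (D : set plane) ->
  planar_bounded D -> bounded_measurable D g -> mu.-integrable D (EFin \o g).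
Proof.
move=> mD bD bg; apply: measurable_bounded_integrable => //.
- exact: planar_bounded_finite.
- exact: bg.1.
- exact: bounded_measurable_bounded.
Qed.

Lemma derive_affine D v (a b c : R) x : D° x ->
  (forall y, D y -> v y = a + b * y.1 + c * y.2) ->
  'D_((1, 0) : R * R) v x = b /\ 'D_((0, 1) : R * R) v x = c.
Proof.
move=> Dx e; pose g (y : R * R) := a + b * y.1 + c * y.2.
have nv : \near x, v x = g x by near=> y; apply: e; near: y.
have D' (w : R * R) l : (forall h, g (h *: w + x) - g x = h * l) -> 'D_w v x = l.
  move=> hl; rewrite (near_eq_derive _ nv); apply: cvg_lim => //.
  apply: cvg_near_cst; near=> h.
  rewrite /= hl /GRing.scale/= mulKf //; near: h; exact: nbhs_dnbhs_neq.
by split; apply: D' => h; rewrite /g /= /GRing.scale /=; ring.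
Unshelve. all: by end_near. Qed.

(** The zero set of [g] has full measure in [D], so it meets each box around
    [x]. *)
Lemma integral0_not_near D g x : open D -> bounded_measurable D g ->
  planar_bounded D -> (forall y, D y -> 0 <= g y) -> D x ->
  \int[mu]_(y in D) g y = 0 -> ~ \near x, g x != 0.
Proof.
move=> oD bg bD g0 Dx ig nx.
have mD := plane_open_measurable oD.
have gi := bounded_measurable_integrable mD bD bg.
have : (\int[mu]_(y in D) `|(EFin \o g) y|)%E = 0%E.
  transitivity (\int[mu]_(y in D) (EFin \o g) y)%E.
    by apply: eq_integral => y /set_mem Dy; rewrite /= ger0_norm ?g0.
  by rewrite -(fineK (integrable_fin_num mD gi)); congr (_%:E).
move=> /(ae_eq_integral_abs mu mD (measurable_int _ gi)) ae0.
have : \near x, D x /\ g x != 0.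
  by near=> y; split; near: y => //; apply: open_nbhs_nbhs.
case/nbhs_ballP => e /= e0 eD.
pose B : set plane := ball x.1 e `*` ball x.2 e.
have mB : measurable B by apply: measurableX; apply: open_measurable; exact: ball_open.
have : mu.-negligible B.
  apply: negligibleS ae0 => y [y1 y2] /= h.
  have [Dy /eqP] := eD y (conj y1 y2).
  by apply; have [] := h Dy.
move=> /(negligibleP mu mB) muB; have : mu B = 0%E := muB; rewrite /B product_measure1E;
  [|by apply: open_measurable; exact: ball_open..].
rewrite /= !lebesgue_measure_ball ?ltW //.
by move=> /eqP; rewrite -EFinM eqe mulf_eq0 orbb mulrn_eq0 /= gt_eqF.
Unshelve. all: by end_near. Qed.

End PlaneMeasure.

(** * Triangles of the mesh *)

Section Triangles.
Set Implicit Arguments.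
Unset Strict Implicit.
Context (R : realType) (M : mesh R).
Implicit Types (A : {set 'I_(nvert M)}) (x : R * R).

Lemma sum_fst (w : 'I_(nvert M) -> R) (F : 'I_(nvert M) -> R * R) :
  (\sum_p w p *: F p).1 = \sum_p w p * (F p).1.
Proof. by rewrite (big_morph (fun y : R * R => y.1) (id1 := 0) (op1 := +%R)). Qed.

Lemma sum_snd (w : 'I_(nvert M) -> R) (F : 'I_(nvert M) -> R * R) :
  (\sum_p w p *: F p).2 = \sum_p w p * (F p).2.
Proof. by rewrite (big_morph (fun y : R * R => y.2) (id1 := 0) (op1 := +%R)). Qed.

Lemma hull_bounded : exists C : R, forall A x, hull A x -> `|x.1| <= C /\ `|x.2| <= C.
Proof.
exists (\sum_(p < nvert M) (`|(vert p).1| + `|(vert p).2|)) => A x [w [w0 _ w1 ->]].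
have wle p : w p <= 1.
  by rewrite -w1 (bigD1 p) //= lerDl sumr_ge0.
rewrite sum_fst sum_snd; split; apply: le_trans (ler_norm_sum _ _ _) _;
  apply: ler_sum => p _; rewrite normrM (ger0_norm (w0 p)).
- by apply: (@le_trans _ _ `|(vert p).1|); rewrite ?lerDl // ler_piMl.
- by apply: (@le_trans _ _ `|(vert p).2|); rewrite ?lerDr // ler_piMl.
Qed.

Definition dirac_weight (p : 'I_(nvert M)) (a : R) q := if q == p then a else 0.

Lemma sum_dirac_weight (V : lmodType R) (F : 'I_(nvert M) -> V) p a :
  \sum_q dirac_weight p a q *: F q = a *: F p.
Proof.
rewrite (bigD1 p) //= /dirac_weight eqxx big1 ?addr0 // => q /negbTE ->.
by rewrite scale0r.
Qed.

Lemma sum_dirac_weight1 p a : \sum_q dirac_weight p a q = a.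
Proof.
rewrite (bigD1 p) //= /dirac_weight eqxx big1 ?addr0 // => q /negbTE -> //.
Qed.

Lemma dirac_weight_out A p s a : p \in A -> s \notin A -> dirac_weight p a s = 0.
Proof.
by move=> pA; rewrite /dirac_weight; case: eqP => // ->; rewrite pA.
Qed.

Lemma segment_hull A p q t : p \in A -> q \in A -> 0 <= t <= 1 ->
  hull A ((1 - t) *: vert p + t *: vert q).
Proof.
move=> pA qA /andP[t0 t1].
exists (fun s => dirac_weight p (1 - t) s + dirac_weight q t s); split.
- by move=> s; rewrite /dirac_weight; do 2 case: ifP => _; lra.
- by move=> s sA; rewrite (@dirac_weight_out _ _ _ _ pA) // (@dirac_weight_out _ _ _ _ qA) // addr0.
- by rewrite big_split/= !sum_dirac_weight1 subrK.
- under eq_bigr do rewrite scalerDl.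
  by rewrite big_split/= !sum_dirac_weight.
Qed.

Lemma vert_hull A p : p \in A -> hull A (vert p).
Proof.
move=> pA; have := @segment_hull A p p 0 pA pA.
by rewrite lexx ler01 subr0 scale1r scale0r addr0; apply.
Qed.

Lemma triangle_edges_independent A p q r (a b : R) :
  affinely_independent A -> p \in A -> q \in A -> r \in A ->
  p != q -> p != r -> q != r ->
  a *: (vert q - vert p) + b *: (vert r - vert p) = 0 -> a = 0 /\ b = 0.
Proof.
move=> iA pA qA rA pq pr qr e.
pose w s := dirac_weight q a s + dirac_weight r b s + dirac_weight p (- (a + b)) s.
have w0 : forall s, w s = 0.
  apply: iA.
  - move=> s sA; rewrite /w (@dirac_weight_out _ _ _ _ pA) // (@dirac_weight_out _ _ _ _ qA) //.
    by rewrite (@dirac_weight_out _ _ _ _ rA) // !addr0.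
  - by rewrite /w !big_split/= !sum_dirac_weight1 subrr.
  - rewrite /w; under eq_bigr do rewrite !scalerDl.
    rewrite !big_split/= !sum_dirac_weight -[RHS]e !scalerBr scaleNr scalerDl.
    by rewrite opprD !addrA; congr (_ - _); rewrite -!addrA; congr (_ + _);
      rewrite addrC.
split.
  by have := w0 q; rewrite /w /dirac_weight eqxx (negbTE qr) eq_sym (negbTE pq) !addr0.
have := w0 r; rewrite /w /dirac_weight eqxx eq_sym (negbTE qr).
by rewrite eq_sym (negbTE pr) addr0 add0r.
Qed.

Lemma vert_neq A p q : affinely_independent A -> p \in A -> q \in A -> p != q ->
  vert p != vert q.
Proof.
move=> iA pA qA pq; apply/eqP => e.
pose w s := dirac_weight p 1 s + dirac_weight q (-1) s.
have w0 : forall s, w s = 0.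
  apply: iA.
  - move=> s sA; rewrite /w (@dirac_weight_out _ _ _ _ pA) // (@dirac_weight_out _ _ _ _ qA) //.
    by rewrite addr0.
  - by rewrite /w big_split/= !sum_dirac_weight1 subrr.
  - rewrite /w; under eq_bigr do rewrite scalerDl.
    by rewrite big_split/= !sum_dirac_weight e scale1r scaleN1r subrr.
have := w0 p; rewrite /w /dirac_weight eqxx (negbTE pq) addr0 => /eqP.
by rewrite oner_eq0.
Qed.

Lemma card3_elements A : #|A| = 3 -> exists p q r,
  [/\ [/\ p \in A, q \in A & r \in A] & [/\ p != q, p != r & q != r]].
Proof.
rewrite cardE; case E : (enum A) => [|p [|q [|r []]]] // _.
have mA s : (s \in A) = (s \in [:: p; q; r]) by rewrite -E mem_enum.
exists p, q, r; rewrite !mA !inE !eqxx !orbT; split=> //.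
have := enum_uniq (mem A); rewrite E /= !inE => /and3P[+ + _].
by rewrite negb_or => /andP[-> ->] ->.
Qed.

Lemma affine_continuous (a b c : R) :
  continuous (fun y : R * R => a + b * y.1 + c * y.2).
Proof.
move=> x; apply: cvgD; first apply: cvgD; first exact: cvg_cst.
- by apply: cvgM; [exact: cvg_cst|exact: cvg_fst].
- by apply: cvgM; [exact: cvg_cst|exact: cvg_snd].
Qed.

(** Around the barycentre the barycentric coordinates, which are affine functions
    of the point, stay positive. *)
Lemma triangle_interior A : #|A| = 3 -> affinely_independent A ->
  exists x, (hull A)° x.
Proof.
move=> /card3_elements[p [q [r [[pA qA rA] [pq pr qr]]]]] iA.
have ind := @triangle_edges_independent A p q r _ _ iA pA qA rA pq pr qr.
pose P := vert p; pose Q := vert q; pose S := vert r.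
pose a1 := Q.1 - P.1; pose a2 := Q.2 - P.2.
pose b1 := S.1 - P.1; pose b2 := S.2 - P.2.
pose d := a1 * b2 - a2 * b1.
have d0 : d != 0.
  apply/eqP => d0.
  have E (a b : R) : a * a1 + b * b1 = 0 -> a * a2 + b * b2 = 0 -> a = 0 /\ b = 0.
    by move=> h1 h2; apply: ind; apply/eqP; rewrite -pair_eqE/= /GRing.scale/=;
      apply/andP; split; apply/eqP.
  have [b10 /oppr_inj] : b1 = 0 /\ - a1 = - 0.
    by rewrite oppr0; apply: E; [ring|rewrite -[RHS]oppr0 -d0 /d; ring].
  move=> a10.
  have [b20 /oppr_inj a20] : b2 = 0 /\ - a2 = - 0.
    by rewrite oppr0; apply: E; [rewrite -d0 /d; ring|ring].
  have [/eqP] : (1 : R) = 0 /\ (0 : R) = 0 by apply: E; rewrite ?a10 ?a20; ring.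
  by rewrite oner_eq0.
(* Cramer's rule for the barycentric coordinates of [x] at [q] and [r]. *)
pose wq x := ((x.1 - P.1) * b2 - (x.2 - P.2) * b1) / d.
pose wr x := (a1 * (x.2 - P.2) - a2 * (x.1 - P.1)) / d.
pose c : R * R := (P.1 + (a1 + b1) / 3, P.2 + (a2 + b2) / 3).
have ctq : continuous wq.
  have -> : wq = fun y => (P.2 * b1 - P.1 * b2) / d + b2 / d * y.1 + - b1 / d * y.2.
    by apply/funext => y; rewrite /wq; field.
  exact: affine_continuous.
have ctr : continuous wr.
  have -> : wr = fun y => (a2 * P.1 - a1 * P.2) / d + - a2 / d * y.1 + a1 / d * y.2.
    by apply/funext => y; rewrite /wr; field.
  exact: affine_continuous.
have wqc : wq c = 1 / 3 by rewrite /wq /c /= /d; field.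
have wrc : wr c = 1 / 3 by rewrite /wr /c /= /d; field.
exists c; rewrite /interior.
have h1 : \near c, 1 / 4 < wq c by apply: (cvgr_gt _ (ctq c)); rewrite wqc; lra.
have h2 : \near c, wq c < 2 / 5 by apply: (cvgr_lt _ (ctq c)); rewrite wqc; lra.
have h3 : \near c, 1 / 4 < wr c by apply: (cvgr_gt _ (ctr c)); rewrite wrc; lra.
have h4 : \near c, wr c < 2 / 5 by apply: (cvgr_lt _ (ctr c)); rewrite wrc; lra.
near=> x.
have : 1 / 4 < wq x by near: x.
have : wq x < 2 / 5 by near: x.
have : 1 / 4 < wr x by near: x.
have : wr x < 2 / 5 by near: x.
move=> k1 k2 k3 k4.
exists (fun s => dirac_weight q (wq x) s + dirac_weight r (wr x) s +
  dirac_weight p (1 - wq x - wr x) s); split.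
- by move=> s; rewrite /dirac_weight; do 3 case: ifP => _; lra.
- move=> s sA; rewrite (@dirac_weight_out _ _ _ _ pA) // (@dirac_weight_out _ _ _ _ qA) //.
  by rewrite (@dirac_weight_out _ _ _ _ rA) // !addr0.
- by rewrite !big_split/= !sum_dirac_weight1; ring.
- under eq_bigr do rewrite !scalerDl.
  rewrite !big_split/= !sum_dirac_weight -/P -/Q -/S.
  apply/eqP; rewrite -pair_eqE/= /GRing.scale/= /wq /wr.
  by apply/andP; split; apply/eqP; move: d0; rewrite /d /a1 /a2 /b1 /b2 => d0; field.
Unshelve. all: by end_near. Qed.

Lemma edist_gt0 (x y : R * R) : x != y -> 0 < Defs.edist x y.
Proof.
move=> xy; rewrite /Defs.edist sqrtr_gt0 lt0r addr_ge0 ?sqr_ge0 // andbT.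
apply: contraNneq xy => /eqP.
rewrite paddr_eq0 ?sqr_ge0 // !sqrf_eq0 !subr_eq0 => /andP[/eqP e1 /eqP e2].
by apply/eqP; case: x y e1 e2 => [? ?] [? ?] /= -> ->.
Qed.

Lemma diam_gt0 (S : set (R * R)) x y : planar_bounded S -> S x -> S y -> x != y ->
  0 < diam S.
Proof.
move=> [C hC] Sx Sy xy; apply: lt_le_trans (edist_gt0 xy) _.
apply: ub_le_sup; last by exists x, y.
exists (Num.sqrt ((2 * C) ^+ 2 + (2 * C) ^+ 2)) => _ [z [w [/hC[z1 z2] /hC[w1 w2] ->]]].
rewrite /Defs.edist ler_sqrt ?addr_ge0 ?sqr_ge0 //.
have sq (s t : R) : `|s| <= C -> `|t| <= C -> (s - t) ^+ 2 <= (2 * C) ^+ 2.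
  rewrite !ler_norml => /andP[? ?] /andP[? ?].
  by nra.
by apply: lerD; apply: sq.
Qed.

End Triangles.

(** * Integrals over fine edges *)

Section FineEdges.
Set Implicit Arguments.
Unset Strict Implicit.
Context (R : realType) (M : mesh R).
Implicit Types (e : 'I_(nvert M) * 'I_(nvert M)) (u v w p q : R * R -> R).

Lemma Rintegral_quadratic (a b c : R) :
  \int[lebesgue_measure]_(t in `[0%R, 1%R]) (a + b * (1 - t) + c * (1 - t) ^+ 2)
    = a + b / 2 + c / 3.
Proof.
have mI : measurable ([set` `[0 : R, 1]] : set (measurableTypeR R)) by exact: measurable_itv.
have iX n (k : R) : lebesgue_measure.-integrable [set` `[0 : R, 1]]
    (EFin \o (fun t => k * (1 - t) ^+ n)).
  have i0 := @integrable_XMonemX R 0 n.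
  have := integrableZl mI k i0; congr (is_true (integrable _ _ _)).
  by apply/funext => t; rewrite /= XMonemX0n.
transitivity (\int[lebesgue_measure]_(t in `[0%R, 1%R])
    ((a * (1 - t) ^+ 0 + b * (1 - t) ^+ 1) + c * (1 - t) ^+ 2)).
  by apply: eq_Rintegral => t _; rewrite expr0 expr1 mulr1.
have i1 (k : R) n : \int[lebesgue_measure]_(t in `[0%R, 1%R]) (k * (1 - t) ^+ n) =
    k / n.+1%:R.
  rewrite RintegralZl ?Rintegral_onemXn //.
  by have := iX n 1; congr (is_true (integrable _ _ _)); apply/funext => t; rewrite /= mul1r.
have i01 : lebesgue_measure.-integrable [set` `[0 : R, 1]]
    (EFin \o (fun t => a * (1 - t) ^+ 0 + b * (1 - t) ^+ 1)).
  by have := integrableD mI (iX 0 a) (iX 1 b).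
rewrite (RintegralD mI i01 (iX 2 c)) (RintegralD mI (iX 0 a) (iX 1 b)) !i1.
by rewrite invr1 mulr1.
Qed.

Definition affine_edge e v : Prop := forall t, 0 <= t <= 1 ->
  v ((1 - t) *: vert e.1 + t *: vert e.2) = (1 - t) * v (vert e.1) + t * v (vert e.2).

(** The integral over [e] of the product of two affine functions, in terms of
    their values at the end points: the element mass matrix of the edge. *)
Definition edge_mass e p q : R :=
  Defs.edist (vert e.1) (vert e.2) / 6 *
  (2 * p (vert e.1) * q (vert e.1) + p (vert e.1) * q (vert e.2) +
   p (vert e.2) * q (vert e.1) + 2 * p (vert e.2) * q (vert e.2)).

Lemma eq_int_fine_edge e (g1 g2 : R * R -> R) :
  (forall x, fine_seg e x -> g1 x = g2 x) -> int_fine_edge e g1 = int_fine_edge e g2.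
Proof.
move=> h; rewrite /int_fine_edge; congr (_ * _); apply: eq_Rintegral => t /set_mem t01.
by apply: h; exists t.
Qed.

Lemma int_fine_edgeM2 e p q r s : affine_edge e p -> affine_edge e q ->
  affine_edge e r -> affine_edge e s ->
  int_fine_edge e (fun x => p x * q x + r x * s x) = edge_mass e p q + edge_mass e r s.
Proof.
move=> ap aq ar as_; rewrite /int_fine_edge /edge_mass.
set p0 := p (vert e.1); set p1 := p (vert e.2).
set q0 := q (vert e.1); set q1 := q (vert e.2).
set r0 := r (vert e.1); set r1 := r (vert e.2).
set s0 := s (vert e.1); set s1 := s (vert e.2).
transitivity (Defs.edist (vert e.1) (vert e.2) *
  \int[lebesgue_measure]_(t in `[0%R, 1%R])
   ((p1 * q1 + r1 * s1) + ((p0 - p1) * q1 + p1 * (q0 - q1) +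
     (r0 - r1) * s1 + r1 * (s0 - s1)) * (1 - t) +
     ((p0 - p1) * (q0 - q1) + (r0 - r1) * (s0 - s1)) * (1 - t) ^+ 2)).
  congr (_ * _); apply: eq_Rintegral => t /set_mem /=; rewrite in_itv/= => t01.
  by rewrite ap // aq // ar // as_ //; rewrite -/p0 -/p1 -/q0 -/q1 -/r0 -/r1 -/s0 -/s1; ring.
rewrite Rintegral_quadratic; by field.
Qed.

Lemma affine_edge0 e : affine_edge e (fun=> 0).
Proof. by move=> t _; rewrite !mulr0 addr0. Qed.

Lemma edge_mass0 e p : edge_mass e (fun=> 0) p = 0.
Proof. by rewrite /edge_mass; ring. Qed.

Lemma int_fine_edgeM e p q : affine_edge e p -> affine_edge e q ->
  int_fine_edge e (fun x => p x * q x) = edge_mass e p q.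
Proof.
move=> ap aq; have a0 := affine_edge0 e.
rewrite -[RHS]addr0 -(edge_mass0 e (fun=> 0)) -int_fine_edgeM2 //.
by apply: eq_int_fine_edge => x _; rewrite mulr0 addr0.
Qed.

Lemma edist_ge0 (x y : R * R) : 0 <= Defs.edist x y.
Proof. exact: sqrtr_ge0. Qed.

Lemma edge_massC e p q : edge_mass e p q = edge_mass e q p.
Proof. by rewrite /edge_mass; ring. Qed.

Lemma edge_mass_lcomb e k u v p :
  edge_mass e p (lcomb k u v) = k * edge_mass e p u + edge_mass e p v.
Proof. by rewrite /edge_mass /lcomb; ring. Qed.

Lemma edge_mass_comb e k p p1 p2 q :
  p (vert e.1) = k * p1 (vert e.1) + p2 (vert e.1) ->
  p (vert e.2) = k * p1 (vert e.2) + p2 (vert e.2) ->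
  edge_mass e p q = k * edge_mass e p1 q + edge_mass e p2 q.
Proof. by rewrite /edge_mass => -> ->; ring. Qed.

Lemma edge_mass_ge0 e p : 0 <= edge_mass e p p.
Proof.
rewrite /edge_mass mulr_ge0 ?divr_ge0 ?edist_ge0 //.
set a := p _; set b := p _.
have -> : 2 * a * a + a * b + b * a + 2 * b * b = a ^+ 2 + b ^+ 2 + (a + b) ^+ 2 by ring.
by rewrite !addr_ge0 ?sqr_ge0.
Qed.

Lemma edge_mass_eq0 e p : vert e.1 != vert e.2 -> edge_mass e p p = 0 ->
  p (vert e.1) = 0 /\ p (vert e.2) = 0.
Proof.
move=> /edist_gt0 l0 /eqP; rewrite /edge_mass mulf_eq0 (gt_eqF (divr_gt0 l0 _)) //=.
set a := p _; set b := p _.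
have -> : 2 * a * a + a * b + b * a + 2 * b * b = a ^+ 2 + b ^+ 2 + (a + b) ^+ 2 by ring.
rewrite paddr_eq0 ?addr_ge0 ?sqr_ge0 // => /andP[+ _].
by rewrite paddr_eq0 ?sqr_ge0 // !sqrf_eq0 => /andP[/eqP -> /eqP ->].
Qed.

Lemma eq_edge_mass e p q p' q' :
  p (vert e.1) = p' (vert e.1) -> p (vert e.2) = p' (vert e.2) ->
  q (vert e.1) = q' (vert e.1) -> q (vert e.2) = q' (vert e.2) ->
  edge_mass e p q = edge_mass e p' q'.
Proof. by rewrite /edge_mass => -> -> -> ->. Qed.

Lemma fine_seg1 e : fine_seg e (vert e.1).
Proof. by exists 0; rewrite /= ?in_itv/= ?lexx ?ler01 // subr0 scale1r scale0r addr0. Qed.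

Lemma fine_seg2 e : fine_seg e (vert e.2).
Proof. by exists 1; rewrite /= ?in_itv/= ?lexx ?ler01 // subrr scale1r scale0r add0r. Qed.

Lemma affine_edge_vanish e v : affine_edge e v -> v (vert e.1) = 0 ->
  v (vert e.2) = 0 -> forall x, fine_seg e x -> v x = 0.
Proof.
move=> av v1 v2 x [t /=]; rewrite in_itv /= => t01 <-.
by rewrite av // v1 v2 !mulr0 addr0.
Qed.

Lemma eq_affine_edge e u v : (forall x, fine_seg e x -> u x = v x) ->
  affine_edge e v -> affine_edge e u.
Proof.
move=> h av t t01; rewrite !h ?av //; [exact: fine_seg2|exact: fine_seg1|].
by exists t.
Qed.

End FineEdges.

(** * Integrals over coarse blocks *)

Section Blocks.
Set Implicit Arguments.
Unset Strict Implicit.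
Context (R : realType) (M : mesh R) (kappa f : R * R -> R).
Context (hM : is_mesh M).
Context (kappa_meas : measurable_fun (domain M) kappa).
Context (kappa_ge1 : forall x, domain M x -> 1 <= kappa x).
Context (kappa_bounded : exists B : R, forall x, domain M x -> kappa x <= B).
Context (f_meas : measurable_fun (domain M) f).
Context (f_L2 : (\int[lebesgue_measure \x lebesgue_measure]_(x in domain M)
     (f x ^+ 2)%:E < +oo)%E).
Local Notation mu := ((@lebesgue_measure R \x @lebesgue_measure R)%E).
Local Notation plane := (measurableTypeR R * measurableTypeR R)%type.
Implicit Types (A : {set 'I_(nvert M)}) (i : 'I_(nblk M)) (E : 'I_(nedge M))
  (e : 'I_(nvert M) * 'I_(nvert M)) (g u v w : R * R -> R).

Lemma blk_tri i A : A \in blk i -> A \in tri M.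
Proof. by move=> Ai; rewrite -(blk_cover hM); apply/bigcupP; exists i. Qed.

Lemma hullo_domain A : A \in tri M -> (hull A)° `<=` domain M.
Proof. by move=> At; apply: interiorS => x Ax; exists A. Qed.

Lemma hullo_measurable A : measurable ((hull A)° : set plane).
Proof. by apply: plane_open_measurable; exact: open_interior. Qed.

Lemma domain_measurable : measurable (domain M : set plane).
Proof. by apply: plane_open_measurable; exact: open_interior. Qed.

Lemma hullo_bounded A : planar_bounded (hull A)°.
Proof.
have [C hC] := hull_bounded M; exists C => x Ax.
by apply: (hC A); apply: interior_subset.
Qed.

Lemma block_bounded i : planar_bounded (block i).
Proof. by have [C hC] := hull_bounded M; exists C => x [A _]; apply: hC. Qed.

Lemma kappa_gt0 x : domain M x -> 0 < kappa x.
Proof. by move/kappa_ge1; apply: lt_le_trans. Qed.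

Lemma kappa_bounded_measurable A : A \in tri M ->
  bounded_measurable (hull A)° kappa.
Proof.
move=> At; split.
  apply: (@measurable_funS _ _ _ _ (domain M)) kappa_meas.
    exact: domain_measurable.
  exact: hullo_domain.
have [B hB] := kappa_bounded; exists B => x /(hullo_domain At) Dx.
by rewrite ger0_norm ?hB // ltW // kappa_gt0.
Qed.

Lemma affine_bounded_measurable A v : affine_on (hull A) v ->
  bounded_measurable (hull A)° v.
Proof.
move=> [a [b [c e]]]; apply: bounded_measurable_affine (@hullo_bounded A) _.
by exists a, b, c => x Ax; apply: e; apply: interior_subset.
Qed.

(** On a set of finite measure [f] is integrable as it is square integrable,
    with [|f| <= 1 + f ^ 2]. *)
Lemma load_integrable A v : A \in tri M -> affine_on (hull A) v ->
  mu.-integrable (hull A)° (EFin \o (fun x => f x * v x)).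
Proof.
move=> At /affine_bounded_measurable bv.
have mD := hullo_measurable A.
have mfD : measurable_fun (hull A)° f.
  apply: (@measurable_funS _ _ _ _ (domain M)) f_meas.
    exact: domain_measurable.
  exact: hullo_domain.
have f2 : mu.-integrable (hull A)° (EFin \o (fun x => f x ^+ 2)).
  apply: (@integrableS _ _ _ mu (domain M)) => //; first exact: domain_measurable.
    exact: hullo_domain.
  apply/integrableP; split.
    by apply/measurable_EFinP; apply: measurable_funX.
  apply: le_lt_trans f_L2; apply: ge0_le_integral => //.
  - exact: domain_measurable.
  - apply: measurableT_comp => //; apply/measurable_EFinP.
    exact: measurable_funX.
  - apply/measurable_EFinP; exact: measurable_funX.
  - by move=> x _; rewrite /= ger0_norm // sqr_ge0.
have i1 : mu.-integrable (hull A)° (EFin \o (fun x => 1 + f x ^+ 2)).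
  have c1 : mu.-integrable (hull A)° (EFin \o (fun=> 1 : R)).
    apply: bounded_measurable_integrable => //; first exact: hullo_bounded.
    exact: bounded_measurable_cst.
  by have := integrableD mD c1 f2.
have fi : mu.-integrable (hull A)° (EFin \o f).
  apply: le_integrable i1 => //; first exact/measurable_EFinP.
  move=> x Dx; rewrite /= lee_fin [leRHS]ger0_norm ?addr_ge0 ?sqr_ge0 //.
  rewrite -(real_normK (num_real (f x))).
  by have := sqr_ge0 (`|f x| - 1); have := normr_ge0 (f x); nra.
have := integrableMl mD fi bv.1 (bounded_measurable_bounded bv).
by [].
Qed.

Lemma affine_onW A v : affine_on (hull A) v -> exists a b c,
  [/\ forall x, hull A x -> v x = a + b * x.1 + c * x.2 &
  forall x, (hull A)° x -> 'D_((1, 0) : R * R) v x = b /\ 'D_((0, 1) : R * R) v x = c].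
Proof.
move=> [a [b [c e]]]; exists a, b, c; split=> // x Ax.
exact: derive_affine Ax e.
Qed.

Lemma affine_on_lcomb A k u v : affine_on (hull A) u -> affine_on (hull A) v ->
  affine_on (hull A) (lcomb k u v).
Proof.
move=> [a [b [c e]]] [a' [b' [c' e']]].
exists (k * a + a'), (k * b + b'), (k * c + c') => x Ax.
by rewrite /lcomb e // e' //; ring.
Qed.

Lemma dot_grad_lcomb A k u v w x : (hull A)° x -> affine_on (hull A) u ->
  affine_on (hull A) v ->
  dot_grad w (lcomb k u v) x = k * dot_grad w u x + dot_grad w v x.
Proof.
move=> Ax /affine_onW[a [b [c [e1 /(_ _ Ax)[d1 d2]]]]].
move=> /affine_onW[a' [b' [c' [e1' /(_ _ Ax)[d1' d2']]]]].
have [] := @derive_affine _ (hull A) (lcomb k u v)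
  (k * a + a') (k * b + b') (k * c + c') x Ax.
  by move=> y Ay; rewrite /lcomb e1 // e1' //; ring.
by rewrite /dot_grad => -> ->; rewrite d1 d2 d1' d2'; ring.
Qed.

Lemma dot_gradC u v x : dot_grad u v x = dot_grad v u x.
Proof. by rewrite /dot_grad mulrC [X in _ + X]mulrC. Qed.

Lemma dot_grad_ge0 u x : 0 <= dot_grad u u x.
Proof. by rewrite /dot_grad -!expr2 addr_ge0 ?sqr_ge0. Qed.

Lemma dot_grad_null A u v x : (forall y, (hull A)° y -> u y = 0) -> (hull A)° x ->
  dot_grad u v x = 0.
Proof.
move=> u0 Ax; have [] := @derive_affine _ (hull A)° u 0 0 0 x.
- by rewrite (interior_id _).1 //; exact: open_interior.
- by move=> y Ay; rewrite u0 //; ring.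
by rewrite /dot_grad => -> ->; rewrite !mul0r addr0.
Qed.

Lemma dot_grad_bounded_measurable A u v : affine_on (hull A) u ->
  affine_on (hull A) v -> bounded_measurable (hull A)° (dot_grad u v).
Proof.
move=> /affine_onW[a [b [c [_ d]]]] /affine_onW[a' [b' [c' [_ d']]]].
apply: (@bounded_measurable_eq _ _ (fun=> b * b' + c * c')).
  by move=> x Ax; rewrite /dot_grad; have [-> ->] := d _ Ax; have [-> ->] := d' _ Ax.
exact: bounded_measurable_cst.
Qed.

Definition block_integrable i g :=
  forall A, A \in blk i -> mu.-integrable (hull A)° (EFin \o g).

Lemma block_integrable_bm i g :
  (forall A, A \in blk i -> bounded_measurable (hull A)° g) -> block_integrable i g.
Proof.
move=> bg A Ai; apply: bounded_measurable_integrable.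
- exact: hullo_measurable.
- exact: hullo_bounded.
- exact: bg.
Qed.

Lemma int_block_lin i k g1 g2 : block_integrable i g1 -> block_integrable i g2 ->
  int_block i (fun x => k * g1 x + g2 x) = k * int_block i g1 + int_block i g2.
Proof.
move=> i1 i2; rewrite /int_block mulr_sumr -big_split/=; apply: eq_bigr => A Ai.
have mD := hullo_measurable A.
have ki : mu.-integrable (hull A)° (EFin \o (fun x => k * g1 x)).
  by have := integrableZl mD k (i1 _ Ai).
by rewrite RintegralD // ?RintegralZl //; [exact: i1|exact: i2].
Qed.

Lemma int_block_ge0 i g :
  (forall A x, A \in blk i -> (hull A)° x -> 0 <= g x) -> 0 <= int_block i g.
Proof. by move=> g0; apply: sumr_ge0 => A Ai; apply: Rintegral_ge0 => x; apply: g0. Qed.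

Lemma eq_int_block i g1 g2 :
  (forall A x, A \in blk i -> (hull A)° x -> g1 x = g2 x) ->
  int_block i g1 = int_block i g2.
Proof.
move=> e; apply: eq_bigr => A Ai; apply: eq_Rintegral => x /set_mem Ax.
exact: e Ai Ax.
Qed.

Lemma int_block0 i g :
  (forall A x, A \in blk i -> (hull A)° x -> g x = 0) -> int_block i g = 0.
Proof.
move=> e; rewrite (@eq_int_block i g (fun=> 0)) // /int_block big1 // => A _.
rewrite Rintegral_cst ?mul0r //; exact: hullo_measurable.
Qed.

Lemma integral_kappa_sqr_eq0 A v : A \in tri M -> affine_on (hull A) v ->
  \int[mu]_(x in (hull A)°) (kappa x * v x * v x) = 0 ->
  forall x, (hull A)° x -> v x = 0.
Proof.
move=> At av iv x Ax; apply/eqP; apply: contrapT => /negP v0.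
have bk := kappa_bounded_measurable At; have bv := affine_bounded_measurable av.
apply: (integral0_not_near (@open_interior _ (hull A))
  (bounded_measurableM (bounded_measurableM bk bv) bv) (@hullo_bounded A) _ Ax iv).
  move=> y Ay; rewrite -mulrA mulr_ge0 -?expr2 ?sqr_ge0 // ltW // kappa_gt0 //.
  exact: hullo_domain Ay.
have [a [b [c e]]] := av.
have nv : \near x, a + b * x.1 + c * x.2 != 0.
  have ca := @affine_continuous R a b c x.
  apply: (cvgr_neq0 (f := fun y : R * R => a + b * y.1 + c * y.2) _ ca).
  by rewrite -e //; exact: interior_subset.
have nA : \near x, (hull A)° x by apply: open_nbhs_nbhs; split=> //; exact: open_interior.
near=> y.
have Ay : (hull A)° y by near: y.
have vy : v y != 0 by rewrite e; [near: y|exact: interior_subset].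
rewrite !mulf_neq0 // gt_eqF // kappa_gt0 //; exact: hullo_domain Ay.
Unshelve. all: by end_near. Qed.

Lemma two_vertices A : A \in tri M -> exists x y, [/\ hull A x, hull A y & x != y].
Proof.
move=> At; have [p [q [r [[pA qA _] [pq _ _]]]]] := card3_elements (tri_card hM At).
exists (vert p), (vert q); split; [exact: vert_hull|exact: vert_hull|].
exact: vert_neq (tri_nondegenerate hM At) pA qA pq.
Qed.

Lemma coarse_size_gt0 i : 0 < coarse_size M.
Proof.
have [A Ai] := blk_neq0 hM i.
have [x [y [Ax Ay xy]]] := two_vertices (blk_tri Ai).
apply: (@lt_le_trans _ _ (diam (block i))).
  by apply: (diam_gt0 (block_bounded i) _ _ xy); exists A.
exact: le_bigmax.
Qed.

Lemma fine_size_gt0 i : 0 < fine_size M.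
Proof.
have [A Ai] := blk_neq0 hM i; have At := blk_tri Ai.
have [x [y [Ax Ay xy]]] := two_vertices At.
apply: (@lt_le_trans _ _ (diam (hull A))).
  apply: (diam_gt0 _ Ax Ay xy).
  by have [C hC] := hull_bounded M; exists C => z; apply: hC.
exact: (le_bigmax_cond _ (fun A => diam (hull A))).
Qed.

Lemma kappaK_ge1 i : 1 <= kappaK kappa i.
Proof.
have [A Ai] := blk_neq0 hM i; have At := blk_tri Ai.
have [x Ax] := triangle_interior (tri_card hM At) (tri_nondegenerate hM At).
have Dx := hullo_domain At Ax.
apply: le_trans (kappa_ge1 Dx) _; apply: ub_le_sup.
  by have [B hB] := kappa_bounded; exists B => _ [y [_ Dy] <-]; exact: hB.
by exists x => //; split=> //; exists A => //; exact: interior_subset.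
Qed.

Lemma kappa_bar_ge1 (E : 'I_(nedge M)) : 1 <= kappa_bar kappa E.
Proof.
rewrite /kappa_bar; case: (kminus E) => [j|]; last exact: kappaK_ge1.
have := kappaK_ge1 (kplus E); have := kappaK_ge1 j; lra.
Qed.

Lemma bedge_cedge i e : e \in bedges (blk i) ->
  exists2 E : 'I_(nedge M), e \in cedge E & edge_of E i.
Proof.
move=> ei; have : e \in (\bigcup_(E < nedge M) cedge E)%SET.
  by rewrite (cedge_cover hM); apply/bigcupP; exists i.
by case/bigcupP => E _ eE; exists E => //; rewrite -(cedge_sides hM eE).
Qed.

Lemma kappa_tilde_ge0 i : 0 <= kappa_tilde kappa i.
Proof. exact: bigmax_ge_id. Qed.

Lemma kappa_tilde_ge1 i e : e \in bedges (blk i) -> 1 <= kappa_tilde kappa i.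
Proof.
case/bedge_cedge => E _ Ei; apply: le_trans (kappa_bar_ge1 E) _.
exact: (le_bigmax_cond _ (fun E => kappa_bar kappa E)).
Qed.

(** * The local spaces and the volume forms *)

Lemma Vh_subspace i : subspace_of (Vh i).
Proof.
split=> [|k u v [cu au] [cv av]].
  split=> [x|A Ai]; first exact: cvg_cst.
  by exists 0, 0, 0 => x _; rewrite !mul0r !addr0.
split=> [x|A Ai]; last by apply: affine_on_lcomb; [exact: au|exact: av].
apply: cvgD; last exact: cv.
by apply: cvgM; [exact: cvg_cst|exact: cu].
Qed.

Lemma Vh0_subspace i : subspace_of (Vh0 i).
Proof.
have [V0 VD] := Vh_subspace i; split=> [//|k u v [Vu u0] [Vv v0]].
split=> [|x bx]; first exact: VD.
by rewrite /lcomb u0 // v0 // mulr0 addr0.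
Qed.

Lemma Vh0_Vh i : Vh0 i `<=` Vh i.
Proof. by move=> v []. Qed.

(** A function that is affine on a triangle is the barycentric combination of its
    values at the vertices. *)
Lemma Vh_findim i : findim (block i) (Vh i).
Proof.
pose V := (\bigcup_(A in blk i) A)%SET.
exists #|V|, (fun k : 'I_(#|V|) => vert (enum_val k)); split=> [k|u [_ au] u0].
  have /bigcupP[A Ai kA] := enum_valP k.
  by exists A => //; exact: vert_hull.
move=> x [A /= Ai Ax]; have [a [b [c e]]] := au _ Ai.
rewrite e //; move: Ax => [w [_ wA w1 ->]]; rewrite sum_fst sum_snd.
transitivity (\sum_p w p * (a + b * (vert p).1 + c * (vert p).2)).
  rewrite -[a in LHS]mulr1 -w1 !mulr_sumr -!big_split/=.
  by apply: eq_bigr => p _; ring.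
rewrite big1 // => p _; have [pA|pA] := boolP (p \in A); last by rewrite wA ?mul0r.
rewrite -e; last exact: vert_hull.
have pV : p \in V by apply/bigcupP; exists A.
by rewrite -(enum_rankK_in pV pV) u0 mulr0.
Qed.

Lemma vanishes_hull i A v x : vanishes (block i) v -> A \in blk i -> hull A x -> v x = 0.
Proof. by move=> v0 Ai Ax; apply: v0; exists A. Qed.

Lemma aK_semi_inner i : semi_inner (block i) (Vh i) (aK kappa i).
Proof.
split=> [u [_ au] k v w [_ av] [_ aw]|u v _ _|u _|u v _ _ u0].
- rewrite /aK -int_block_lin; last 2 first.
  + apply: block_integrable_bm => A Ai; apply: bounded_measurableM.
      exact: kappa_bounded_measurable (blk_tri Ai).
    by apply: dot_grad_bounded_measurable; [exact: au|exact: av].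
  + apply: block_integrable_bm => A Ai; apply: bounded_measurableM.
      exact: kappa_bounded_measurable (blk_tri Ai).
    by apply: dot_grad_bounded_measurable; [exact: au|exact: aw].
  apply: eq_int_block => A x Ai Ax.
  by rewrite (dot_grad_lcomb k u Ax (av _ Ai) (aw _ Ai)); ring.
- by apply: eq_int_block => A x _ _; rewrite dot_gradC.
- apply: int_block_ge0 => A x Ai Ax; rewrite mulr_ge0 ?dot_grad_ge0 //.
  by rewrite ltW // kappa_gt0 //; exact: hullo_domain (blk_tri Ai) _ Ax.
- apply: int_block0 => A x Ai Ax; rewrite (dot_grad_null (A := A)) ?mulr0 //.
  by move=> y Ay; apply: (vanishes_hull u0 Ai); exact: interior_subset.
Qed.

Lemma b2_semi_inner i : semi_inner (block i) (Vh i) (b2 kappa i).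
Proof.
have H0 : 0 <= (coarse_size M ^+ 2)^-1 by rewrite invr_ge0 sqr_ge0.
have bi u v : Vh i u -> Vh i v -> block_integrable i (fun x => kappa x * u x * v x).
  move=> [_ au] [_ av]; apply: block_integrable_bm => A Ai.
  apply: bounded_measurableM; first apply: bounded_measurableM.
  - exact: kappa_bounded_measurable (blk_tri Ai).
  - by apply: affine_bounded_measurable; apply: au.
  - by apply: affine_bounded_measurable; apply: av.
split=> [u Vu k v w Vv Vw|u v _ _|u _|u v _ _ u0]; rewrite /b2.
- rewrite mulrCA -mulrDr -int_block_lin; [|exact: bi..].
  by congr (_ * _); apply: eq_int_block => A x _ _; rewrite /lcomb; ring.
- by congr (_ * _); apply: eq_int_block => A x _ _; ring.
- rewrite mulr_ge0 //; apply: int_block_ge0 => A x Ai Ax.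
  rewrite -mulrA mulr_ge0 -?expr2 ?sqr_ge0 //.
  by rewrite ltW // kappa_gt0 //; exact: hullo_domain (blk_tri Ai) _ Ax.
- rewrite int_block0 ?mulr0 // => A x Ai Ax.
  by rewrite (vanishes_hull u0 Ai) ?mulr0 ?mul0r //; exact: interior_subset.
Qed.

Lemma b2_eq0_aK i v : Vh i v -> b2 kappa i v v = 0 -> aK kappa i v v = 0.
Proof.
move=> [_ av] /eqP; rewrite mulf_eq0 invr_eq0 expf_eq0/=.
rewrite (gt_eqF (coarse_size_gt0 i)) /= psumr_eq0 => [/allP v0|A Ai]; last first.
  apply: Rintegral_ge0 => x Ax; rewrite -mulrA mulr_ge0 -?expr2 ?sqr_ge0 //.
  by rewrite ltW // kappa_gt0 //; exact: hullo_domain (blk_tri Ai) _ Ax.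
apply: int_block0 => A x Ai Ax; rewrite (dot_grad_null (A := A)) ?mulr0 //.
apply: integral_kappa_sqr_eq0 (blk_tri Ai) (av _ Ai) _.
by apply/eqP; have := v0 A (mem_index_enum A); rewrite Ai.
Qed.

Lemma load_linear i : linear_on (Vh i) (fun v => int_block i (fun x => f x * v x)).
Proof.
move=> k u v [_ au] [_ av]; rewrite -int_block_lin; last 2 first.
- by move=> A Ai; apply: load_integrable (blk_tri Ai) (au _ Ai).
- by move=> A Ai; apply: load_integrable (blk_tri Ai) (av _ Ai).
by apply: eq_int_block => A x _ _; rewrite /lcomb; ring.
Qed.

Lemma load_null i v : vanishes (block i) v -> int_block i (fun x => f x * v x) = 0.
Proof.
move=> v0; apply: int_block0 => A x Ai Ax.
by rewrite (vanishes_hull v0 Ai) ?mulr0 //; exact: interior_subset.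
Qed.

(** * Traces, harmonic extensions and fluxes *)

Lemma bedge_vertices i e : e \in bedges (blk i) -> exists A,
  [/\ A \in blk i, e.1 \in A, e.2 \in A & vert e.1 != vert e.2].
Proof.
rewrite inE => /andP[e12 /cards1P[A /setP/(_ A)]].
rewrite !inE eqxx => /and3P[Ai e1 e2]; exists A; split=> //.
apply: vert_neq (tri_nondegenerate hM (blk_tri Ai)) e1 e2 _.
by apply: contraTneq e12 => ->; rewrite ltnn.
Qed.

Lemma fine_seg_hull A e x : e.1 \in A -> e.2 \in A -> fine_seg e x ->
  hull A x.
Proof.
by move=> e1 e2 [t /=]; rewrite in_itv/= => t01 <-; exact: segment_hull.
Qed.

Lemma bd_block i x : bd i x -> block i x.
Proof.
move=> [e /= /bedge_vertices[A [Ai e1 e2 _]] ex].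
by exists A => //; exact: fine_seg_hull ex.
Qed.

Lemma fine_seg_bd i e x : e \in bedges (blk i) -> fine_seg e x -> bd i x.
Proof. by move=> ei ex; exists e. Qed.

Lemma Vh_affine_edge i e v : Vh i v -> e \in bedges (blk i) -> affine_edge e v.
Proof.
move=> [_ av] /bedge_vertices[A [Ai e1 e2 _]] t t01.
have [a [b [c h]]] := av _ Ai.
rewrite !h; [|exact: vert_hull..|exact: segment_hull].
by rewrite /= /GRing.scale/=; ring.
Qed.

Lemma Vh_Vhb i : Vh i `<=` Vhb i.
Proof. by move=> v Vv; exists v. Qed.

Lemma Vhb_affine_edge i e v : Vhb i v -> e \in bedges (blk i) -> affine_edge e v.
Proof.
move=> [w Vw vw] ei; apply: (@eq_affine_edge _ _ _ _ w).
  by move=> x ex; apply: vw; exact: fine_seg_bd ex.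
exact: Vh_affine_edge Vw ei.
Qed.

Lemma Vhb_subspace i : subspace_of (Vhb i).
Proof.
have [V0 VD] := Vh_subspace i; split=> [|k u v [u' Vu eu] [v' Vv ev]].
  exact: Vh_Vhb.
exists (lcomb k u' v'); first exact: VD.
by move=> x bx; rewrite /lcomb eu // ev.
Qed.

Definition trace_form i u v : R := \sum_(e in bedges (blk i)) edge_mass e u v.

Lemma int_bd_trace i u v : Vhb i u -> Vhb i v ->
  int_bd i (fun x => u x * v x) = trace_form i u v.
Proof.
move=> Vu Vv; apply: eq_bigr => e ei; apply: int_fine_edgeM.
- exact: Vhb_affine_edge Vu ei.
- exact: Vhb_affine_edge Vv ei.
Qed.

Lemma eq_trace_form i u v u' v' : (forall x, bd i x -> u x = u' x) ->
  (forall x, bd i x -> v x = v' x) -> trace_form i u v = trace_form i u' v'.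
Proof.
move=> eu ev; apply: eq_bigr => e ei; apply: eq_edge_mass.
- by apply: eu; apply: fine_seg_bd ei _; exact: fine_seg1.
- by apply: eu; apply: fine_seg_bd ei _; exact: fine_seg2.
- by apply: ev; apply: fine_seg_bd ei _; exact: fine_seg1.
- by apply: ev; apply: fine_seg_bd ei _; exact: fine_seg2.
Qed.

Lemma trace_form_ge0 i u : 0 <= trace_form i u u.
Proof. by apply: sumr_ge0 => e _; exact: edge_mass_ge0. Qed.

Lemma trace_form_linear i u S : linear_on S (trace_form i u).
Proof.
move=> k v w _ _; rewrite /trace_form mulr_sumr -big_split/=.
by apply: eq_bigr => e _; rewrite edge_mass_lcomb.
Qed.

Lemma trace_formC i u v : trace_form i u v = trace_form i v u.
Proof. by apply: eq_bigr => e _; exact: edge_massC. Qed.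

Lemma trace_form_null i u v : (forall x, bd i x -> u x = 0) -> trace_form i u v = 0.
Proof.
move=> u0; rewrite (@eq_trace_form i u v (fun=> 0) v) // /trace_form big1 // => e _.
exact: edge_mass0.
Qed.

Lemma trace_form_eq0 i v : Vhb i v -> trace_form i v v = 0 ->
  forall x, bd i x -> v x = 0.
Proof.
move=> Vv /eqP; rewrite psumr_eq0 => [/allP v0|e _]; last exact: edge_mass_ge0.
move=> x [e /= ei ex]; have [A [Ai e1 e2 e12]] := bedge_vertices ei.
have := v0 e (mem_index_enum e); rewrite ei => /eqP me0.
have [] := edge_mass_eq0 e12 me0.
by move=> v1 v2; exact: affine_edge_vanish (Vhb_affine_edge Vv ei) v1 v2 _ ex.
Qed.

Lemma trace_semi_inner i : semi_inner (block i) (Vh i) (trace_form i).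
Proof.
split=> [u _|u v _ _|u _|u v _ _ u0].
- exact: trace_form_linear.
- exact: trace_formC.
- exact: trace_form_ge0.
- by apply: trace_form_null => x /bd_block; exact: u0.
Qed.

Local Notation is_harm i := (is_harmonic_ext kappa i).

(** The extension is a lifting [w] of the boundary values corrected by the
    solution in [Vh0 i] of the problem with right-hand side [- aK w z].  This
    right-hand side annihilates the null vectors of the energy by
    Cauchy-Schwarz, so [riesz] applies to the semi-definite energy. *)
Lemma harmonic_exists i v : Vhb i v -> exists w, is_harm i v w.
Proof.
move=> [w Vw vw]; have sa := aK_semi_inner i.
have s0 := semi_innerW (@Vh0_Vh i) sa.
have [| |q Vq hq] := riesz (Vh0_subspace i) (findimW (@Vh0_Vh i) (Vh_findim i))
    s0 (F := fun z => - aK kappa i w z).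
- by move=> k u z [Vu _] [Vz _]; rewrite (si_lin sa Vw k Vu Vz) opprD mulrN.
- move=> z Vz0 hz; have Vz := Vh0_Vh Vz0; rewrite (si_sym sa) //.
  by rewrite (null_orthogonal (Vh_subspace i) sa Vz Vw) ?oppr0 // hz.
exists (fun x => w x + q x); split.
- by apply: subspace_add (Vh_subspace i) Vw (Vh0_Vh Vq).
- by move=> x bx; rewrite Vq.2 // addr0 vw.
- move=> z Vz0; have Vz := Vh0_Vh Vz0; rewrite (si_sym sa) //; last first.
    by apply: subspace_add (Vh_subspace i) Vw (Vh0_Vh Vq).
  rewrite (linear_add (si_lin sa Vz) (Vh_subspace i) Vw (Vh0_Vh Vq)).
  rewrite (si_sym sa) // (si_sym sa Vz (Vh0_Vh Vq)) hq //.
  by rewrite subrr.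
Qed.

Lemma harmonic_lcomb i k v1 v2 w1 w2 : is_harm i v1 w1 -> is_harm i v2 w2 ->
  is_harm i (lcomb k v1 v2) (lcomb k w1 w2).
Proof.
move=> [V1 e1 h1] [V2 e2 h2]; have sa := aK_semi_inner i.
have V12 := (Vh_subspace i).2 k _ _ V1 V2.
split; [exact: V12|by move=> x bx; rewrite /lcomb e1 // e2|move=> z Vz0].
have Vz := Vh0_Vh Vz0; rewrite (si_sym sa) // (si_lin sa) //.
by rewrite (si_sym sa) // h1 // (si_sym sa) // h2 // mulr0 addr0.
Qed.

(** Two harmonic extensions of the same boundary values differ by a null vector of
    the energy, so the energy cannot tell them apart; this replaces
    uniqueness of the extension. *)
Lemma harmonic_null i v w u : (forall x, bd i x -> v x = 0) -> is_harm i v w ->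
  Vh i u -> aK kappa i u w = 0.
Proof.
move=> v0 [Vw e h] Vu; have sa := aK_semi_inner i.
have Vw0 : Vh0 i w by split=> // x bx; rewrite e // v0.
rewrite (si_sym sa) // (null_orthogonal (Vh_subspace i) sa Vw Vu) //.
exact: h.
Qed.

Lemma harmonic_aK_congr i v v' w w' u : (forall x, bd i x -> v x = v' x) ->
  is_harm i v w -> is_harm i v' w' -> Vh i u -> aK kappa i u w = aK kappa i u w'.
Proof.
move=> vv' hw hw' Vu; have sa := aK_semi_inner i.
have Vw : Vh i w by case: hw.
have Vw' : Vh i w' by case: hw'.
have := harmonic_null _ (harmonic_lcomb (-1) hw' hw) Vu.
rewrite (si_lin sa Vu (-1) Vw' Vw) mulN1r addrC => H.
apply/eqP; rewrite -subr_eq0 H // => x bx.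
by rewrite /lcomb vv' // mulN1r addNr.
Qed.

Definition hext i v := xget (fun=> 0) (is_harm i v).

Lemma hextP i v : Vhb i v -> is_harm i v (hext i v).
Proof. by move=> /harmonic_exists[w hw]; apply: xgetPex; exists w. Qed.

(** The flux represents [v |-> aK u (hext v)] in the trace inner product. *)
Lemma flux_exists i u : Vh i u -> exists q, is_flux kappa i u q.
Proof.
move=> Vu; have sa := aK_semi_inner i; have sV := Vh_subspace i.
have hV v : Vh i v -> is_harm i v (hext i v) by move=> Vv; apply/hextP/Vh_Vhb.
have [| |q Vq hq] := riesz sV (Vh_findim i)
    (trace_semi_inner i) (F := fun z => aK kappa i u (hext i z)).
- move=> k v w Vv Vw.
  rewrite (harmonic_aK_congr (v' := lcomb k v w) _ (hV _ (sV.2 k _ _ Vv Vw))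
    (harmonic_lcomb k (hV _ Vv) (hV _ Vw)) Vu); last by [].
  have [Vhv _ _] := hV _ Vv; have [Vhw _ _] := hV _ Vw.
  by rewrite (si_lin sa Vu k Vhv Vhw).
- move=> z Vz hz; apply: harmonic_null (hV _ Vz) Vu.
  by apply: trace_form_eq0; [exact: Vh_Vhb|exact: hz].
exists q; split; first exact: Vh_Vhb.
move=> v w Vv hw; rewrite int_bd_trace //; last exact: Vh_Vhb.
have [v' Vv' vv'] := Vv.
rewrite (@eq_trace_form i q v q v'); [|by []|exact: vv'].
rewrite (hq _ Vv'); apply: harmonic_aK_congr (hV _ Vv') hw Vu => x bx.
by rewrite vv'.
Qed.

Lemma fluxP i u : Vh i u -> is_flux kappa i u (flux kappa i u).
Proof. by move=> /flux_exists[q hq]; apply: xgetPex; exists q. Qed.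

Lemma flux_Vhb i u : Vh i u -> Vhb i (flux kappa i u).
Proof. by move=> /fluxP[]. Qed.

Lemma flux_trace i u v w : Vh i u -> Vhb i v -> is_harm i v w ->
  trace_form i (flux kappa i u) v = aK kappa i u w.
Proof.
move=> Vu Vv hw; have [Vq hq] := fluxP Vu.
by rewrite -(hq _ _ Vv hw) int_bd_trace.
Qed.

(** Both sides represent the same functional of the trace, and the trace form is
    definite on the boundary. *)
Lemma flux_lcomb i k u v x : Vh i u -> Vh i v -> bd i x ->
  flux kappa i (lcomb k u v) x = k * flux kappa i u x + flux kappa i v x.
Proof.
move=> Vu Vv bx; have sa := aK_semi_inner i.
have Vuv := (Vh_subspace i).2 k _ _ Vu Vv.
have bs := Vhb_subspace i.
have Vr := bs.2 k _ _ (flux_Vhb Vu) (flux_Vhb Vv).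
pose d := lcomb (-1) (lcomb k (flux kappa i u) (flux kappa i v))
  (flux kappa i (lcomb k u v)).
have Vd : Vhb i d by apply: bs.2 => //; exact: flux_Vhb.
have hw := hextP Vd; have Vw : Vh i (hext i d) by case: hw.
suff /(_ x bx) : forall x, bd i x -> d x = 0.
  by rewrite /d /lcomb mulN1r addrC => /eqP; rewrite subr_eq0 => /eqP.
apply: trace_form_eq0 => //.
have tl a b c z : trace_form i (lcomb (-1) (lcomb k a b) c) z =
    - (k * trace_form i a z + trace_form i b z) + trace_form i c z.
  have L := @trace_form_linear i z setT.
  by rewrite !(trace_formC _ _ z) (L _ _ _ I I) (L _ _ _ I I) mulN1r.
apply: etrans (tl _ _ _ d) _.
have eu := flux_trace Vu Vd hw; have ev := flux_trace Vv Vd hw.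
have euv := etrans (flux_trace Vuv Vd hw) (si_linl k (Vh_subspace i) sa Vu Vv Vw).
have alg (a b c a' b' : R) : a = a' -> b = b' -> c = k * a' + b' ->
    - (k * a + b) + c = 0 by move=> -> -> ->; rewrite addNr.
exact: alg eu ev euv.
Qed.

(** * The bilinear form on the broken space *)

Definition dglcomb (k : R) (u v : dgfun M) : dgfun M := fun i => lcomb k (u i) (v i).

Lemma VDG_dglcomb k (u v : dgfun M) : VDG u -> VDG v -> VDG (dglcomb k u v).
Proof. by move=> Vu Vv i; apply: (Vh_subspace i).2; [exact: Vu|exact: Vv]. Qed.

Lemma cedge_bedge E e i : e \in cedge E -> edge_of E i ->
  e \in bedges (blk i).
Proof. by move=> eE Ei; rewrite (cedge_sides hM eE). Qed.

Lemma edge_of_plus E : edge_of E (kplus E).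
Proof. by rewrite /edge_of eqxx. Qed.

Lemma edge_of_minus E j : kminus E = Some j -> edge_of E j.
Proof. by rewrite /edge_of => ->; rewrite eqxx orbT. Qed.

Lemma affine_edge_jump E e (G : dgfun M) :
  (forall i, edge_of E i -> affine_edge e (G i)) -> affine_edge e (jump E G).
Proof.
move=> aG; rewrite /jump; case Em: (kminus E) => [j|]; last exact/aG/edge_of_plus.
have a1 := aG _ (edge_of_plus E); have a2 := aG _ (edge_of_minus Em).
by move=> t t01; rewrite a1 // a2 //; ring.
Qed.

Lemma affine_edge_avg E e (G : dgfun M) :
  (forall i, edge_of E i -> affine_edge e (G i)) -> affine_edge e (avg E G).
Proof.
move=> aG; rewrite /avg; case Em: (kminus E) => [j|]; last exact/aG/edge_of_plus.
have a1 := aG _ (edge_of_plus E); have a2 := aG _ (edge_of_minus Em).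
by move=> t t01; rewrite a1 // a2 //; field.
Qed.

Lemma VDG_affine_edge E e (u : dgfun M) : VDG u -> e \in cedge E ->
  affine_edge e (jump E u).
Proof.
move=> Vu eE; apply: affine_edge_jump => i Ei.
exact: Vh_affine_edge (Vu i) (cedge_bedge eE Ei).
Qed.

Lemma affine_edge_flux E e (u : dgfun M) : VDG u -> e \in cedge E ->
  affine_edge e (avg E (edge_flux kappa E u)).
Proof.
move=> Vu eE; apply: affine_edge_avg => i Ei.
have aq := Vhb_affine_edge (flux_Vhb (Vu i)) (cedge_bedge eE Ei).
move: aq; rewrite /edge_flux; move: (flux kappa i (u i)) => q aq.
by move=> t t01; case: (i == kplus E); rewrite aq //; ring.
Qed.

Definition flux_term (u v : dgfun M) : R :=
  \sum_(E < nedge M) \sum_(e in cedge E)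
    edge_mass e (avg E (edge_flux kappa E u)) (jump E v).

Definition jump_term (u v : dgfun M) : R :=
  \sum_(E < nedge M) \sum_(e in cedge E)
    kappa_bar kappa E * edge_mass e (jump E u) (jump E v).

Lemma edge_massZl e (k : R) p q : edge_mass e (fun x => k * p x) q = k * edge_mass e p q.
Proof. by rewrite /edge_mass; ring. Qed.

(** On fine edges all the factors are affine, so each edge integral is a sum of
    values of [edge_mass], for which bilinearity and symmetry are algebraic. *)
Lemma aDG_terms gamma (u v : dgfun M) : VDG u -> VDG v ->
  aDG kappa gamma u v = aH kappa u v - (flux_term u v + flux_term v u)
    + gamma / fine_size M * jump_term u v.
Proof.
move=> Vu Vv; rewrite /aDG; congr (_ - _ + _).
  rewrite /flux_term -big_split/=; apply: eq_bigr => E _.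
  rewrite -big_split/=; apply: eq_bigr => e eE.
  apply: int_fine_edgeM2.
  - exact: affine_edge_flux.
  - exact: VDG_affine_edge.
  - exact: affine_edge_flux.
  - exact: VDG_affine_edge.
rewrite mulr_sumr; apply: eq_bigr => E _; congr (_ * _).
apply: eq_bigr => e eE; rewrite -edge_massZl; apply: int_fine_edgeM.
  by move=> t t01; rewrite (VDG_affine_edge Vu eE) //; ring.
exact: VDG_affine_edge.
Qed.

Lemma jump_dglcomb E k (u v : dgfun M) x :
  jump E (dglcomb k u v) x = k * jump E u x + jump E v x.
Proof. by rewrite /jump /dglcomb /lcomb; case: (kminus E) => [j|]; ring. Qed.

Lemma aH_linear k (u v w : dgfun M) : VDG u -> VDG v -> VDG w ->
  aH kappa u (dglcomb k v w) = k * aH kappa u v + aH kappa u w.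
Proof.
move=> Vu Vv Vw; rewrite /aH mulr_sumr -big_split/=; apply: eq_bigr => i _.
exact: si_lin (aK_semi_inner i) _ (Vu i) k _ _ (Vv i) (Vw i).
Qed.

Lemma flux_term_linearr k (u v w : dgfun M) :
  flux_term u (dglcomb k v w) = k * flux_term u v + flux_term u w.
Proof.
rewrite /flux_term mulr_sumr -big_split/=; apply: eq_bigr => E _.
rewrite mulr_sumr -big_split/=; apply: eq_bigr => e _.
rewrite -edge_mass_lcomb; apply: eq_edge_mass => //; exact: jump_dglcomb.
Qed.

Lemma edge_flux_dglcomb E k (u v : dgfun M) e x : VDG u -> VDG v ->
  e \in cedge E -> fine_seg e x ->
  avg E (edge_flux kappa E (dglcomb k u v)) x =
    k * avg E (edge_flux kappa E u) x + avg E (edge_flux kappa E v) x.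
Proof.
move=> Vu Vv eE ex.
have h i : edge_of E i -> edge_flux kappa E (dglcomb k u v) i x =
    k * edge_flux kappa E u i x + edge_flux kappa E v i x.
  move=> Ei; have bx := fine_seg_bd (cedge_bedge eE Ei) ex.
  have alg (s : bool) (a b c : R) : c = k * a + b ->
      (if s then c else - c) =
        k * (if s then a else - a) + (if s then b else - b).
    by case: s => // ->; ring.
  exact: alg (i == kplus E) _ _ _ (flux_lcomb k (Vu i) (Vv i) bx).
have alg2 (a1 b1 c1 a2 b2 c2 : R) : c1 = k * a1 + b1 -> c2 = k * a2 + b2 ->
  (c1 + c2) / 2 = k * ((a1 + a2) / 2) + (b1 + b2) / 2 by move=> -> ->; field.
rewrite /avg; case Em: (kminus E) => [j|]; last exact/h/edge_of_plus.
exact: alg2 (h _ (edge_of_plus E)) (h _ (edge_of_minus Em)).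
Qed.

Lemma flux_term_linearl k (u v w : dgfun M) : VDG u -> VDG v ->
  flux_term (dglcomb k u v) w = k * flux_term u w + flux_term v w.
Proof.
move=> Vu Vv; rewrite /flux_term mulr_sumr -big_split/=; apply: eq_bigr => E _.
rewrite mulr_sumr -big_split/=; apply: eq_bigr => e eE.
by apply: edge_mass_comb; apply: edge_flux_dglcomb Vu Vv eE _;
  [exact: fine_seg1|exact: fine_seg2].
Qed.

Lemma jump_term_linear k (u v w : dgfun M) :
  jump_term u (dglcomb k v w) = k * jump_term u v + jump_term u w.
Proof.
have alg (c x y z : R) : x = k * y + z -> c * x = k * (c * y) + c * z.
  by move=> ->; ring.
rewrite /jump_term mulr_sumr -big_split/=; apply: eq_bigr => E _.
rewrite mulr_sumr -big_split/=; apply: eq_bigr => e _; apply: alg.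
by rewrite -edge_mass_lcomb; apply: eq_edge_mass => //; exact: jump_dglcomb.
Qed.

Lemma aDG_linear gamma k (u v w : dgfun M) : VDG u -> VDG v -> VDG w ->
  aDG kappa gamma u (dglcomb k v w) = k * aDG kappa gamma u v + aDG kappa gamma u w.
Proof.
move=> Vu Vv Vw; have Vvw := VDG_dglcomb k Vv Vw.
have alg (g a a1 a2 b b1 b2 c c1 c2 d d1 d2 : R) :
    a = k * a1 + a2 -> b = k * b1 + b2 -> c = k * c1 + c2 -> d = k * d1 + d2 ->
    a - (b + c) + g * d = k * (a1 - (b1 + c1) + g * d1) + (a2 - (b2 + c2) + g * d2).
  by move=> -> -> -> ->; ring.
have sum2 (a b c b' c' : R) : b = b' -> c = c' -> a = k * b' + c' -> a = k * b + c.
  by move=> -> ->.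
apply: etrans (aDG_terms gamma Vu Vvw) _.
apply: sum2 (aDG_terms gamma Vu Vv) (aDG_terms gamma Vu Vw) _.
apply: alg; [exact: aH_linear|exact: flux_term_linearr|exact: flux_term_linearl|].
exact: jump_term_linear.
Qed.

Lemma aDGC gamma (u v : dgfun M) : VDG u -> VDG v -> aDG kappa gamma u v = aDG kappa gamma v u.
Proof.
move=> Vu Vv.
have alg (g a a' b c d d' : R) : a = a' -> d = d' ->
    a - (b + c) + g * d = a' - (c + b) + g * d'.
  by move=> -> ->; rewrite [b + c]addrC.
apply: etrans (aDG_terms gamma Vu Vv) (etrans _ (esym (aDG_terms gamma Vv Vu))).
apply: alg.
  by apply: eq_bigr => i _; exact: si_sym (aK_semi_inner i) _ _ (Vu i) (Vv i).
by apply: eq_bigr => E _; apply: eq_bigr => e _; rewrite edge_massC.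
Qed.

Lemma flux_null i (u : R * R -> R) x : Vh i u -> vanishes (block i) u -> bd i x ->
  flux kappa i u x = 0.
Proof.
move=> Vu u0; have Vq := flux_Vhb Vu; have hw := hextP Vq.
apply: (trace_form_eq0 Vq); apply: etrans (flux_trace Vu Vq hw) _.
have [Vw _ _] := hw; exact: (si_null (aK_semi_inner i) Vu Vw u0).
Qed.

Lemma aDG_null gamma (u v : dgfun M) : VDG u -> VDG v -> (forall i, vanishes (block i) (v i)) ->
  aDG kappa gamma u v = 0.
Proof.
move=> Vu Vv v0.
have J0 E e x : e \in cedge E -> fine_seg e x -> jump E v x = 0.
  move=> eE ex; have h i (Ei : edge_of E i) : v i x = 0.
    by apply/v0/bd_block/(fine_seg_bd (cedge_bedge eE Ei) ex).
  rewrite /jump; case Em: (kminus E) => [j|]; rewrite h ?edge_of_plus //.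
  by rewrite h ?subrr // edge_of_minus.
have F0 E e x : e \in cedge E -> fine_seg e x ->
    avg E (edge_flux kappa E v) x = 0.
  move=> eE ex; have h i (Ei : edge_of E i) : edge_flux kappa E v i x = 0.
    have := flux_null (Vv i) (v0 i) (fine_seg_bd (cedge_bedge eE Ei) ex).
    by rewrite /edge_flux => ->; rewrite oppr0 if_same.
  rewrite /avg; case Em: (kminus E) => [j|]; rewrite h ?edge_of_plus //.
  by rewrite h ?addr0 ?mul0r // edge_of_minus.
have m0 e p q : p (vert e.1) = 0 -> p (vert e.2) = 0 -> edge_mass e p q = 0.
  by rewrite /edge_mass => -> ->; ring.
have alg (g a b c d : R) : a = 0 -> b = 0 -> c = 0 -> d = 0 ->
    a - (b + c) + g * d = 0 by move=> -> -> -> ->; ring.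
apply: etrans (aDG_terms gamma Vu Vv) _; apply: alg.
- apply: big1 => i _; apply: etrans (si_sym (aK_semi_inner i) (Vu i) (Vv i)) _.
  exact: (si_null (aK_semi_inner i) (Vv i) (Vu i) (v0 i)).
- apply: big1 => E _; apply: big1 => e eE; rewrite edge_massC.
  by apply: m0; apply: J0 eE _; [exact: fine_seg1|exact: fine_seg2].
- apply: big1 => E _; apply: big1 => e eE.
  by apply: m0; apply: F0 eE _; [exact: fine_seg1|exact: fine_seg2].
- apply: big1 => E _; apply: big1 => e eE; rewrite edge_massC m0 ?mulr0 //.
    by apply: J0 eE _; exact: fine_seg1.
  by apply: J0 eE _; exact: fine_seg2.
Qed.

(** Each boundary edge of a block lies in exactly one coarse edge, and the blocks
    that have it on their boundary are the sides of that coarse edge. *)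
Lemma sum_bedges (F : 'I_(nblk M) -> 'I_(nvert M) * 'I_(nvert M) -> R) :
  \sum_i \sum_(e in bedges (blk i)) F i e =
  \sum_(E < nedge M) \sum_(e in cedge E) \sum_(i | edge_of E i) F i e.
Proof.
pose U := (\bigcup_(E < nedge M) cedge E)%SET.
transitivity (\sum_(e in U) \sum_(i | e \in bedges (blk i)) F i e).
  rewrite (exchange_big_dep xpredT) //= [RHS]big_mkcond /=.
  apply: eq_bigr => e _; case: ifPn => // eU; rewrite big1 // => i ei.
  move: eU; rewrite /U (cedge_cover hM) => /negP[].
  by apply/bigcupP; exists i.
rewrite /U partition_disjoint_bigcup /=; last first.
  by move=> E1 E2 /(cedge_disjoint hM) E12; rewrite -setI_eq0 E12.
apply: eq_bigr => E _; apply: eq_bigr => e eE; apply: eq_bigl => i.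
exact: cedge_sides hM _ _ eE i.
Qed.

(** * Coercivity *)

Lemma edge_young e (s : R) p q : 0 < s ->
  `|2 * edge_mass e p q| <= s * edge_mass e p p + s^-1 * edge_mass e q q.
Proof.
move=> s0.
have sq (k : R) : 0 <= k ^+ 2 * edge_mass e p p + 2 * k * edge_mass e p q + edge_mass e q q.
  have := edge_mass_ge0 e (lcomb k p q).
  by rewrite /edge_mass /lcomb; congr (_ <= _); ring.
have E (k : R) : k ^+ 2 = s ^+ 2 -> - (2 * (k / s) * edge_mass e p q) <=
    s * edge_mass e p p + s^-1 * edge_mass e q q.
  move=> ks; have := sq k; rewrite ks.
  move: (edge_mass e p p) (edge_mass e p q) (edge_mass e q q) => a b c abc.
  have -> : - (2 * (k / s) * b) = - (2 * k * b) / s by field; rewrite gt_eqF.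
  have -> : s * a + s^-1 * c = (s ^+ 2 * a + c) / s by field; rewrite gt_eqF.
  by apply: ler_wpM2r; [rewrite invr_ge0 ltW|move: abc; lra].
rewrite ler_norml; apply/andP; split.
  by have := E s erefl; rewrite divff ?gt_eqF //; lra.
have := E (- s) (sqrrN s); rewrite mulNr divff ?gt_eqF //; lra.
Qed.

Lemma edge_mass_half e p q1 q2 r :
  p (vert e.1) = (q1 (vert e.1) - q2 (vert e.1)) / 2 ->
  p (vert e.2) = (q1 (vert e.2) - q2 (vert e.2)) / 2 ->
  2 * edge_mass e p r = edge_mass e q1 r - edge_mass e q2 r.
Proof. by rewrite /edge_mass => -> ->; field. Qed.

(** Taking the flux [q] itself as a test function gives
    [trace q q = aK u (hext q)]; after Cauchy-Schwarz the inverse inequality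
    bounds the energy of [hext q] by [trace q q] again. *)
Lemma flux_bound Cinv i u : inverse_inequality M kappa Cinv -> Vh i u ->
  trace_form i (flux kappa i u) (flux kappa i u) <=
    kappaK kappa i * Cinv ^+ 2 * (fine_size M)^-1 * aK kappa i u u.
Proof.
move=> inv Vu; have Vq := flux_Vhb Vu; have hw := hextP Vq; have [Vw _ _] := hw.
have h1 := flux_trace Vu Vq hw; have h2 := inv _ _ _ Vq hw.
have h3 := cauchy_schwarz (Vh_subspace i) (aK_semi_inner i) Vu Vw.
have h4 := si_ge0 (aK_semi_inner i) Vu.
have X0 : 0 <= kappaK kappa i * Cinv ^+ 2 * (fine_size M)^-1.
  have h0 := ltW (fine_size_gt0 i); have k0 := le_trans ler01 (kappaK_ge1 i).
  by apply: mulr_ge0; [apply: mulr_ge0; rewrite ?sqr_ge0|rewrite invr_ge0].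
have T0 := trace_form_ge0 i (flux kappa i u).
have h5 : int_bd i (fun x => `|flux kappa i u x| ^+ 2) =
    trace_form i (flux kappa i u) (flux kappa i u).
  apply: etrans (int_bd_trace Vq Vq); congr int_bd; apply/funext => x.
  by rewrite real_normK ?num_real // expr2.
have alg (T a A W X Y : R) : T = a -> a ^+ 2 <= A * W -> W <= X * Y -> Y = T ->
    0 <= T -> 0 <= A -> 0 <= X -> T <= X * A.
  move=> <- aAW /[swap] -> WXT Tge0 A0 Xge0; have [->|Tn0] := eqVneq T 0; first exact: mulr_ge0.
  have Tpos : 0 < T by rewrite lt0r Tn0.
  rewrite -(ler_pM2r Tpos) -expr2; apply: le_trans aAW _.
  by rewrite [X * A]mulrC -mulrA ler_wpM2l.
exact: alg h1 h3 h2 h5 T0 h4 X0.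
Qed.

(** Young's inequality on each side of the edge, with weight
    [h / (gamma * kappaK i)], produces [gamma * kappaK i / h] in front of
    the jump.  On an interior edge the average carries a factor [1 / 2], and
    [kappa_bar] is the mean of the [kappaK i] over the two sides, so the jump
    part is exactly the penalty. *)
Lemma edge_flux_bound gamma (u : dgfun M) E e : 0 < gamma -> VDG u -> e \in cedge E ->
  2 * edge_mass e (avg E (edge_flux kappa E u)) (jump E u) <=
    \sum_(i | edge_of E i) fine_size M / (gamma * kappaK kappa i) *
      edge_mass e (flux kappa i (u i)) (flux kappa i (u i))
    + gamma / fine_size M * (kappa_bar kappa E * edge_mass e (jump E u) (jump E u)).
Proof.
move=> g0 Vu eE; have h0 := fine_size_gt0 (kplus E).
set h := fine_size M in h0 *.
have k0 i : 0 < kappaK kappa i by exact: lt_le_trans (kappaK_ge1 i).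
have s0 i : 0 < h / (gamma * kappaK kappa i) by rewrite divr_gt0 // mulr_gt0.
have Y q i := edge_young e q (jump E u) (s0 i).
have J0 := edge_mass_ge0 e (jump E u); have Q0 q := edge_mass_ge0 e q.
rewrite /kappa_bar; case Em: (kminus E) => [j|]; last first.
  have -> : \sum_(i | edge_of E i) h / (gamma * kappaK kappa i) *
      edge_mass e (flux kappa i (u i)) (flux kappa i (u i)) =
      h / (gamma * kappaK kappa (kplus E)) *
      edge_mass e (flux kappa (kplus E) (u (kplus E))) (flux kappa (kplus E) (u (kplus E))).
    apply: big_pred1 => i.
    by rewrite /edge_of Em orbF eq_sym.
  have -> : avg E (edge_flux kappa E u) = flux kappa (kplus E) (u (kplus E)).
    by apply/funext => x; rewrite /avg Em /edge_flux eqxx.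
  move: (flux _ _ _) => q.
  have := Y q (kplus E); rewrite invf_div ler_norml => /andP[_].
  have alg (a b c : R) : a / h * (b * c) = a * b / h * c by ring.
  by move=> y1; rewrite alg.
have jk : j != kplus E.
  by have := kminus_neq hM E; rewrite Em; apply: contraNneq => ->.
have -> (F : 'I_(nblk M) -> R) : \sum_(i | edge_of E i) F i = F (kplus E) + F j.
  rewrite (bigD1 (kplus E)) ?edge_of_plus //=; congr (_ + _).
  apply: big_pred1 => i; rewrite /edge_of Em /= [kplus E == i]eq_sym.
  have [->|ik] := eqVneq i (kplus E); first by rewrite andbF eq_sym (negbTE jk).
  by rewrite /= andbT; apply/eqP/eqP => [[->]|->].
have av x : avg E (edge_flux kappa E u) x =
    (flux kappa (kplus E) (u (kplus E)) x - flux kappa j (u j) x) / 2.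
  by rewrite /avg Em /edge_flux eqxx (negbTE jk).
rewrite (edge_mass_half _ (av _) (av _)).
move: (flux kappa (kplus E) _) (flux kappa j _) => q1 q2.
have := Y q1 (kplus E); have := Y q2 j.
rewrite !invf_div !ler_norml => /andP[y2 _] /andP[_ y1].
have p1 : 0 <= h / (gamma * kappaK kappa (kplus E)) * edge_mass e q1 q1.
  by rewrite mulr_ge0 // ltW.
have p2 : 0 <= h / (gamma * kappaK kappa j) * edge_mass e q2 q2.
  by rewrite mulr_ge0 // ltW.
have -> : gamma / h * ((kappaK kappa (kplus E) + kappaK kappa j) / 2 *
    edge_mass e (jump E u) (jump E u)) =
    (gamma * kappaK kappa (kplus E) / h * edge_mass e (jump E u) (jump E u) +
     gamma * kappaK kappa j / h * edge_mass e (jump E u) (jump E u)) / 2.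
  by field; rewrite gt_eqF.
move: y1 y2 p1 p2; lra.
Qed.

(** By [edge_flux_bound] the flux terms cost the whole penalty and a sum over the
    block boundaries, which [flux_bound] bounds by [Cinv ^ 2 / gamma] times
    the energy. *)
Lemma aDG_coercive gamma Cinv (u : dgfun M) : 0 < gamma ->
  inverse_inequality M kappa Cinv -> VDG u ->
  (1 - Cinv ^+ 2 / gamma) * aH kappa u u <= aDG kappa gamma u u.
Proof.
move=> g0 inv Vu.
have fb : 2 * flux_term u u <= Cinv ^+ 2 / gamma * aH kappa u u
    + gamma / fine_size M * jump_term u u.
  apply: (@le_trans _ _ (\sum_(E < nedge M) \sum_(e in cedge E)
    (\sum_(i | edge_of E i) fine_size M / (gamma * kappaK kappa i) *
      edge_mass e (flux kappa i (u i)) (flux kappa i (u i))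
    + gamma / fine_size M * (kappa_bar kappa E * edge_mass e (jump E u) (jump E u))))).
    rewrite mulr_sumr; apply: ler_sum => E _; rewrite mulr_sumr; apply: ler_sum => e eE.
    exact: edge_flux_bound g0 Vu eE.
  under eq_bigr do rewrite big_split /= -mulr_sumr.
  rewrite big_split/= -mulr_sumr; apply: lerD; last by [].
  rewrite -(sum_bedges (fun i e => fine_size M / (gamma * kappaK kappa i) *
      edge_mass e (flux kappa i (u i)) (flux kappa i (u i)))).
  rewrite /aH mulr_sumr; apply: ler_sum => i _; rewrite -mulr_sumr.
  have alg (h k T A : R) : 0 < h -> 0 < k -> T <= k * Cinv ^+ 2 * h^-1 * A ->
      h / (gamma * k) * T <= Cinv ^+ 2 / gamma * A.
    move=> h0 k0 TA; have -> : Cinv ^+ 2 / gamma * A =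
        h / (gamma * k) * (k * Cinv ^+ 2 * h^-1 * A).
      by field; rewrite !gt_eqF.
    by apply: ler_wpM2l TA; rewrite ltW // divr_gt0 // mulr_gt0.
  apply: alg (fine_size_gt0 i) (lt_le_trans ltr01 (kappaK_ge1 i)) _.
  exact: flux_bound inv (Vu i).
have alg (x a F c J : R) : x = a - (F + F) + J -> 2 * F <= c * a + J ->
    (1 - c) * a <= x by move=> ->; lra.
exact: alg (aDG_terms gamma Vu Vu) fb.
Qed.

(** * Snapshot spaces and residuals *)

Lemma trace_formZl i k u v : trace_form i (fun x => k * u x) v = k * trace_form i u v.
Proof.
rewrite /trace_form mulr_sumr; apply: eq_bigr => e _; exact: edge_massZl.
Qed.

Lemma b1E i u v : Vh i u -> Vh i v -> b1 kappa i u v =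
  (coarse_size M)^-1 * kappa_tilde kappa i * trace_form i u v.
Proof.
move=> Vu Vv; rewrite /b1 -mulrA; congr (_ * _).
have Vku : Vhb i (fun x => kappa_tilde kappa i * u x).
  exists (lcomb (kappa_tilde kappa i) u (fun=> 0)).
    by apply: (Vh_subspace i).2 => //; exact: (Vh_subspace i).1.
  by move=> x _; rewrite /lcomb addr0.
apply: etrans (int_bd_trace Vku (Vh_Vhb Vv)) _; exact: trace_formZl.
Qed.

Lemma b1_semi_inner i : semi_inner (block i) (Vh i) (b1 kappa i).
Proof.
have c0 : 0 <= (coarse_size M)^-1 * kappa_tilde kappa i.
  by rewrite mulr_ge0 ?invr_ge0 ?kappa_tilde_ge0 // ltW // (coarse_size_gt0 i).
split=> [u Vu k v w Vv Vw|u v Vu Vv|u Vu|u v Vu Vv u0].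
- have Vvw := (Vh_subspace i).2 k _ _ Vv Vw.
  rewrite !b1E // (si_lin (trace_semi_inner i)) //; ring.
- by rewrite !b1E // trace_formC.
- by rewrite b1E // mulr_ge0 // trace_form_ge0.
- by rewrite b1E // (si_null (trace_semi_inner i)) // mulr0.
Qed.

Lemma V1snap_Vh i : V1snap kappa i `<=` Vh i.
Proof. by move=> w [v _ []]. Qed.

Lemma V1snap_subspace i : subspace_of (V1snap kappa i).
Proof.
have [V0 _] := Vh_subspace i; split=> [|k u v [u' Vu hu] [v' Vv hv]].
  exists (fun=> 0); first exact: Vh_Vhb.
  split=> // z /Vh0_Vh Vz; exact: (si_null (aK_semi_inner i)).
exists (lcomb k u' v'); last exact: harmonic_lcomb.
exact: (Vhb_subspace i).2.
Qed.

(** Such a [v] vanishes on the boundary, where [kappa_tilde] is at least [1], so it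
    is a harmonic extension of zero. *)
Lemma b1_eq0_aK i v : V1snap kappa i v -> b1 kappa i v v = 0 -> aK kappa i v v = 0.
Proof.
move=> Sv b0; have Vv := V1snap_Vh Sv; have [g Vg hv] := Sv; have [_ vg _] := hv.
suff v0 x : bd i x -> v x = 0.
  by apply: harmonic_null hv Vv => x bx; rewrite -vg // v0.
move=> bx; have [e /= ei _] := bx.
move: b0; rewrite b1E // => /eqP.
rewrite !mulf_eq0 invr_eq0 (gt_eqF (coarse_size_gt0 i)).
rewrite (gt_eqF (lt_le_trans ltr01 (kappa_tilde_ge1 ei))) /= => /eqP t0.
exact: trace_form_eq0 (Vh_Vhb Vv) t0 _ bx.
Qed.

Lemma ext0_VDG i v : Vh i v -> VDG (ext0 i v).
Proof.
by move=> Vv j; rewrite /ext0; case: eqP => [->//|_]; exact: (Vh_subspace j).1.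
Qed.

Lemma ext0_lcomb i k u v : ext0 i (lcomb k u v) = dglcomb k (ext0 i u) (ext0 i v).
Proof.
apply/funext => j; rewrite /ext0 /dglcomb; case: eqP => // _.
by apply/funext => x; rewrite /lcomb mulr0 addr0.
Qed.

Section Residual.
Context (gamma : R) (uH : dgfun M) (VuH : VDG uH).
Local Notation res := (residual kappa gamma f uH).

Lemma residual_linear i : linear_on (Vh i) (res i).
Proof.
move=> k u v Vu Vv.
have alg (a b a1 b1 a2 b2 : R) : a = k * a1 + a2 -> b = k * b1 + b2 ->
    a - b = k * (a1 - b1) + (a2 - b2) by move=> -> ->; ring.
apply: alg; first exact: load_linear.
rewrite ext0_lcomb; apply: aDG_linear VuH _ _; exact: ext0_VDG.
Qed.

Lemma residual_null i v : Vh i v -> vanishes (block i) v -> res i v = 0.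
Proof.
move=> Vv v0; rewrite /residual load_null // aDG_null ?subr0 //; first exact: ext0_VDG.
by move=> j; rewrite /ext0; case: eqP => [->//|_] x.
Qed.

Lemma nonzero_onP i v : nonzero_on i v <-> ~ vanishes (block i) v.
Proof.
split=> [[x Kx /eqP v0] vK|vK]; first by apply: v0; exact: vK.
apply: contrapT => h; apply: vK => x Kx; apply/eqP; apply: contrapT => /negP v0.
by apply: h; exists x.
Qed.

Lemma residual_norm_ge0 i S b : 0 <= residual_norm kappa gamma f uH i S b.
Proof.
rewrite /residual_norm; set E := (X in sup X).
have [->|/set0P[x Ex]] := eqVneq E set0; first by rewrite sup0.
have [ubE|nubE] := pselect (has_ubound E); last by rewrite sup_out // => -[].
apply: le_trans (ub_le_sup ubE Ex).
by have [v _ <-] := Ex; rewrite divr_ge0 ?sqrtr_ge0.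
Qed.

(** The quotients in [residual_norm] are bounded, because the residual has a
    representative [q] for [b] by [riesz] and thus satisfies
    [|res v| <= sqrt (b q q) * sqrt (b v v)]; only then is their supremum an
    upper bound. *)
Lemma residual_le i S b v : S `<=` Vh i -> subspace_of S ->
  semi_inner (block i) S b -> (forall v, S v -> b v v = 0 -> vanishes (block i) v) ->
  S v -> `|res i v| <= residual_norm kappa gamma f uH i S b * Num.sqrt (b v v).
Proof.
move=> SV sS sb db Sv.
have [v0|/nonzero_onP v0] := pselect (vanishes (block i) v).
  rewrite residual_null ?normr0 ?mulr_ge0 ?residual_norm_ge0 ?sqrtr_ge0 //.
  exact: SV.
have bpos w : S w -> nonzero_on i w -> 0 < Num.sqrt (b w w).
  move=> Sw /nonzero_onP w0; rewrite sqrtr_gt0 lt0r (si_ge0 sb) // andbT.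
  by apply/eqP => e; apply: w0; exact: db.
have [z Sz hz|q Sq hq] := riesz sS (findimW SV (Vh_findim i)) sb
    (linear_onW SV (@residual_linear i)).
  by apply: residual_null; [exact: SV|apply: db => //; exact: hz].
rewrite -ler_pdivrMr ?bpos //; apply: ub_le_sup; last by exists v.
exists (Num.sqrt (b q q)) => _ [w [Sw w0] <-].
rewrite ler_pdivrMr ?bpos // -hq // -sqrtrM ?(si_ge0 sb) //.
by rewrite -sqrtr_sqr ler_wsqrtr // (cauchy_schwarz sS sb).
Qed.

(** A member of the broken space is the sum of the extensions by zero of its
    restrictions; members are read as functions on pairs of a block and a
    point in order to apply [linear_sumf]. *)
Lemma residual_sum (w : dgfun M) : VDG w ->
  load f w - aDG kappa gamma uH w = \sum_i res i (w i).
Proof.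
move=> Vw; rewrite /residual sumrB; congr (_ - _).
pose T := ('I_(nblk M) * (R * R))%type.
pose cur (U : T -> R) : dgfun M := fun i x => U (i, x).
pose S : set (T -> R) := [set U | VDG (cur U)].
pose g i : T -> R := fun jx => ext0 i (w i) jx.1 jx.2.
have sS : subspace_of S.
  split=> [i|k U W VU VW]; first exact: (Vh_subspace i).1.
  exact: VDG_dglcomb VU VW.
have lF : linear_on S (fun U => aDG kappa gamma uH (cur U)).
  by move=> k U W VU VW; apply: aDG_linear VuH VU VW.
have Sg i : S (g i) by apply: ext0_VDG; exact: Vw.
have := linear_sumf (fun=> 1) sS lF Sg.
have -> : cur (sumf (fun=> 1) g) = w.
  apply/funext => i; apply/funext => x; rewrite /cur /sumf (bigD1 i) //=.
  rewrite big1 => [|j ji]; first by rewrite /g /= /ext0 eqxx mul1r addr0.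
  by rewrite /g /= /ext0 eq_sym (negbTE ji) mulr0.
by move=> ->; apply: eq_bigr => i _; rewrite mul1r.
Qed.

End Residual.

(** * The error estimate *)

Lemma spectral_remainder i S b n (g : nat -> R * R -> R) (lam : nat -> R) l v :
  S `<=` Vh i -> subspace_of S -> semi_inner (block i) (Vh i) b ->
  (forall z, S z -> b z z = 0 -> aK kappa i z z = 0) ->
  eigenpairs kappa i S b n g lam -> (l < n)%N -> S v ->
  (forall z, S z -> b z z = 0 -> vanishes (block i) z) /\
  exists c : nat -> R, let r := fun x => v x - \sum_(k < l) c k * g k x in
    S r /\ lam l * b r r <= aK kappa i v v.
Proof.
move=> SV sS sb nb [eq lt all] ln Sv.
have sbS := semi_innerW SV sb; have saS := semi_innerW SV (aK_semi_inner i).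
have fS := findimW SV (Vh_findim i).
have eig k : (k < n)%N -> [/\ S (g k), ~ vanishes (block i) (g k) &
    forall v, S v -> aK kappa i (g k) v = lam k * b (g k) v].
  by move=> /eq[? /nonzero_onP].
have comp w m : S w -> ~ vanishes (block i) w ->
    (forall z, S z -> aK kappa i w z = m * b w z) ->
    exists k, [/\ (k < n)%N, m = lam k &
    exists c, forall x, block i x -> w x = c * g k x].
  by move=> Sw /nonzero_onP w0 e; apply: all.
split=> [z|]; first exact: eigen_definite sS saS sbS nb comp z.
exact: spectral_gap sS fS saS sbS nb eig lt comp l v ln Sv.
Qed.

Lemma Vh_congr i u v : (forall x, block i x -> u x = v x) -> Vh i u -> Vh i v.
Proof.
move=> uv [cu au]; split=> [|A Ai].
  by apply: subspace_eq_continuous cu => x /set_mem; exact: uv.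
have [a [b [c e]]] := au _ Ai; exists a, b, c => x Ax.
by rewrite -uv ?e //; exists A.
Qed.

Lemma span_Vh i n (g : nat -> R * R -> R) v : (forall k, (k < n)%N -> Vh i (g k)) ->
  span_on i n g v -> Vh i v.
Proof.
move=> Vg [c vE]; apply: (@Vh_congr i (sumf (fun k : 'I_n => c k) (fun k : 'I_n => g k))).
  by move=> x Kx; rewrite vE.
by apply: subspace_sumf (Vh_subspace i) _ => k; exact: Vg.
Qed.

Lemma Voff_VDG (l1 l2 : 'I_(nblk M) -> nat)
  (phi xi : 'I_(nblk M) -> nat -> R * R -> R) (u : dgfun M) :
  (forall i k, (k < l1 i)%N -> Vh i (phi i k)) ->
  (forall i k, (k < l2 i)%N -> Vh i (xi i k)) ->
  Voff l1 l2 phi xi u -> VDG u.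
Proof.
move=> Vphi Vxi off i; have [v1 [v2 [s1 s2 uE]]] := off i.
apply: (@Vh_congr i (fun x => v1 x + v2 x)); first by move=> x Kx; rewrite uE.
by apply: subspace_add (Vh_subspace i) (span_Vh _ s1) (span_Vh _ s2) => k;
  [exact: Vphi|exact: Vxi].
Qed.

Lemma aK_harmonic_split i u w : Vh i u -> is_harm i u w ->
  aK kappa i u u = aK kappa i w w +
    aK kappa i (fun x => u x - w x) (fun x => u x - w x).
Proof.
move=> Vu [Vw wu hw]; have sV := Vh_subspace i; have sa := aK_semi_inner i.
have Vz : Vh i (fun x => u x - w x) by exact: subspace_sub.
have z0 : aK kappa i w (fun x => u x - w x) = 0.
  by apply: hw; split=> // x bx; rewrite wu // subrr.
have uE : u = lcomb 1 w (fun x => u x - w x).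
  by apply/funext => x; rewrite /lcomb mul1r addrC subrK.
have alg (a b c d : R) : c = 0 -> d = 1 ^+ 2 * a + 2 * 1 * c + b -> d = a + b.
  by move=> -> ->; ring.
apply: alg z0 _; apply: etrans (semi_inner_square 1 sV sa Vw Vz).
by rewrite -uE.
Qed.

(** Young's inequality with the free parameter [t], which later takes the value
    of the inverse coercivity constant. *)
Lemma young_term (N y a lam t : R) : 0 < t -> 0 < lam -> 0 <= y ->
  lam * y <= a -> N * Num.sqrt y <= t / 2 * (N ^+ 2 * lam^-1) + a / (2 * t).
Proof.
move=> t0 l0 y0 ya.
have [s s0 sl] : exists2 s, 0 < s & s ^+ 2 = lam.
  by exists (Num.sqrt lam); rewrite ?sqrtr_gt0 // sqr_sqrtr // ltW.
set r := Num.sqrt y; have ry : r ^+ 2 = y by rewrite sqr_sqrtr.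
have h : N * r <= t / 2 * (N ^+ 2 * lam^-1) + lam * y / (2 * t).
  have -> : t / 2 * (N ^+ 2 * lam^-1) + lam * y / (2 * t) =
      N * r + (t * N / s - s * r) ^+ 2 / (2 * t).
    by rewrite -sl -ry; field; rewrite !gt_eqF.
  by rewrite lerDl divr_ge0 ?sqr_ge0 // mulr_ge0 // ltW.
apply: le_trans h _; rewrite lerD2l ler_wpM2r // invr_ge0 mulr_ge0 // ltW //.
Qed.

Lemma residual_split (t x x1 x2 y1 y2 s1 s2 A A1 A2 : R) :
  x = x1 + x2 -> A = A1 + A2 -> `|x1| <= y1 -> `|x2| <= y2 ->
  y1 <= t / 2 * s1 + A1 / (2 * t) -> y2 <= t / 2 * s2 + A2 / (2 * t) ->
  `|x| <= t / 2 * (s1 + s2) + A / (2 * t).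
Proof.
move=> -> -> h1 h2 h3 h4; apply: le_trans (ler_normD _ _) _.
apply: le_trans (lerD (le_trans h1 h3) (le_trans h2 h4)) _.
rewrite le_eqVlt; apply/orP; left; apply/eqP; ring.
Qed.

(** With [e = uh - uH], the energy [X = aDG e e] is the residual at [e], which equals
    the residual at the spectral remainder of [e] by Galerkin orthogonality.
    [young_term] bounds the latter by [t / 2] times the sum of the indicators
    plus [aH e e / (2 t)], and the last term is at most [X / 2] by coercivity
    with constant [1 / t]. *)
Lemma energy_error_bound (gamma Cinv : R) (m1 m2 l1 l2 : 'I_(nblk M) -> nat)
    (phi xi : 'I_(nblk M) -> nat -> R * R -> R)
    (lambda1 lambda2 : 'I_(nblk M) -> nat -> R) (uh uH : dgfun M) :
  0 < gamma -> Cinv ^+ 2 < gamma ->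
  inverse_inequality M kappa Cinv ->
  (forall i, eigenpairs kappa i (V1snap kappa i) (b1 kappa i)
               (m1 i) (phi i) (lambda1 i)) ->
  (forall i, eigenpairs kappa i (V2snap i) (b2 kappa i)
               (m2 i) (xi i) (lambda2 i)) ->
  (forall i, (l1 i < m1 i)%N /\ 0 < lambda1 i (l1 i)) ->
  (forall i, (l2 i < m2 i)%N /\ 0 < lambda2 i (l2 i)) ->
  VDG uh ->
  Voff l1 l2 phi xi uH ->
  (forall v : dgfun M, VDG v -> aDG kappa gamma uh v = load f v) ->
  (forall v : dgfun M, Voff l1 l2 phi xi v -> aDG kappa gamma uH v = load f v) ->
  energy_norm kappa gamma (fun i x => uh i x - uH i x) ^+ 2 <=
    (1 - Cinv ^+ 2 / gamma)^-1 * \sum_(i < nblk M)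
      (residual_norm kappa gamma f uH i (V1snap kappa i) (b1 kappa i) ^+ 2
         * (lambda1 i (l1 i))^-1
       + residual_norm kappa gamma f uH i (V2snap i) (b2 kappa i) ^+ 2
         * (lambda2 i (l2 i))^-1).
Proof.
move=> gamma_gt0 gamma_large.
have d0 : 0 < 1 - Cinv ^+ 2 / gamma by rewrite subr_gt0 ltr_pdivrMr // mul1r.
set t := (1 - Cinv ^+ 2 / gamma)^-1; have t0 : 0 < t by rewrite invr_gt0.
move=> inv eig1 eig2 hl1 hl2 Vuh offH eh eH.
have Vphi i k : (k < l1 i)%N -> Vh i (phi i k).
  move=> kl; apply: (@V1snap_Vh i).
  by have [+ _ _] := eig1 i; case/(_ k (ltn_trans kl (hl1 i).1)).
have Vxi i k : (k < l2 i)%N -> Vh i (xi i k).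
  move=> kl; apply: (@Vh0_Vh i).
  by have [+ _ _] := eig2 i; case/(_ k (ltn_trans kl (hl2 i).1)).
have VuH : VDG uH := Voff_VDG Vphi Vxi offH.
pose e : dgfun M := dglcomb (-1) uH uh.
have eE : (fun i x => uh i x - uH i x) = e.
  by apply/funext => i; apply/funext => x; rewrite /e /dglcomb /lcomb mulN1r addrC.
have Ve : VDG e by apply: VDG_dglcomb.
rewrite eE.
pose sV i := @Vh_subspace i.
pose N1 i := residual_norm kappa gamma f uH i (V1snap kappa i) (b1 kappa i).
pose N2 i := residual_norm kappa gamma f uH i (V2snap i) (b2 kappa i).
pose res i v := residual kappa gamma f uH i v.
(* The error on a block splits into its harmonic extension [w] and the bubble
   [z], orthogonal in energy; each has its own spectral remainder. *)
have block_split i : exists (r : R * R -> R) (p : R * R -> R),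
  [/\ forall x, e i x = r x + p x, Vh i r,
      exists v1 v2, [/\ span_on i (l1 i) (phi i) v1, span_on i (l2 i) (xi i) v2 &
        forall x, block i x -> p x = v1 x + v2 x] &
      `|res i r| <= t / 2 * (N1 i ^+ 2 * (lambda1 i (l1 i))^-1
          + N2 i ^+ 2 * (lambda2 i (l2 i))^-1) + aK kappa i (e i) (e i) / (2 * t)].
  have Vei := Ve i.
  have hw := hextP (Vh_Vhb Vei); set w := hext i (e i) in hw.
  have [Vw we _] := hw.
  pose z := fun x => e i x - w x.
  have S1w : V1snap kappa i w by exists (e i) => //; exact: Vh_Vhb.
  have S2z : V2snap i z.
    split; first exact: subspace_sub.
    by move=> x bx; rewrite /z we // subrr.
  have [def1 [c1 [Sr1 r1le]]] := spectral_remainder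
    (@V1snap_Vh i) (V1snap_subspace i)
    (b1_semi_inner i) (@b1_eq0_aK i)
    (eig1 i) (hl1 i).1 S1w.
  have [def2 [c2 [Sr2 r2le]]] := spectral_remainder
    (@Vh0_Vh i) (Vh0_subspace i)
    (b2_semi_inner i)
    (fun v Sv => @b2_eq0_aK i v (Vh0_Vh Sv))
    (eig2 i) (hl2 i).1 S2z.
  set r1 := (fun x => w x - _) in Sr1 r1le.
  set r2 := (fun x => z x - _) in Sr2 r2le.
  pose p1 := fun x => \sum_(k < l1 i) c1 k * phi i k x.
  pose p2 := fun x => \sum_(k < l2 i) c2 k * xi i k x.
  have Vr1 := V1snap_Vh Sr1; have Vr2 := Vh0_Vh Sr2.
  exists (fun x => r1 x + r2 x), (fun x => p1 x + p2 x); split.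
  - by move=> x; rewrite /r1 /r2 /p1 /p2 /z; ring.
  - exact: subspace_add (sV i) Vr1 Vr2.
  - by exists p1, p2; split=> //; [exists c1|exists c2].
  have rl := residual_linear gamma VuH (i := i).
  have R1 := residual_le gamma VuH (@V1snap_Vh i)
    (V1snap_subspace i)
    (semi_innerW (@V1snap_Vh i) (b1_semi_inner i)) def1 Sr1.
  have R2 := residual_le gamma VuH (@Vh0_Vh i)
    (Vh0_subspace i)
    (semi_innerW (@Vh0_Vh i) (b2_semi_inner i)) def2 Sr2.
  have Y1 := young_term (N1 i) t0 (hl1 i).2
    (si_ge0 (b1_semi_inner i) Vr1) r1le.
  have Y2 := young_term (N2 i) t0 (hl2 i).2
    (si_ge0 (b2_semi_inner i) Vr2) r2le.
  apply: residual_split (linear_add rl (sV i) Vr1 Vr2)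
    (aK_harmonic_split Vei hw) R1 R2 Y1 Y2.
have [rp hrp] := choice block_split.
have {hrp} [p hp] := choice hrp.
have Voffp : Voff l1 l2 phi xi p by move=> i; have [_ _] := hp i.
have Vp : VDG p := Voff_VDG Vphi Vxi Voffp.
have Vr : VDG rp by move=> i; have [] := hp i.
have eRP : e = dglcomb 1 rp p.
  apply/funext => i; apply/funext => x; rewrite /dglcomb /lcomb mul1r.
  by have [-> _ _ _] := hp i.
pose X := aDG kappa gamma e e.
have Xres : X = \sum_i res i (rp i).
  (* Testing the equation for [uh] with any [v] shows that [e] represents
     the residual; it vanishes at [p], which lies in the offline space. *)
  have Ge (v : dgfun M) : VDG v -> aDG kappa gamma e v = load f v - aDG kappa gamma uH v.
    move=> Vv; have alg (a a' b b' c L : R) : a = a' -> a' = -1 * b + c ->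
      b = b' -> c = L -> a = L - b' by move=> -> -> -> ->; rewrite mulN1r addrC.
    apply: alg (aDGC gamma Ve Vv)
      (aDG_linear gamma (-1) Vv VuH Vuh)
      (aDGC gamma Vv VuH) _.
    exact: etrans (aDGC gamma Vv Vuh) (eh _ Vv).
  have alg (a b c d u L L' : R) : a = 1 * b + c -> b = L - d -> c = L' - u -> u = L' ->
      a = L - d by move=> -> -> -> ->; ring.
  apply: etrans (residual_sum gamma VuH Vr).
  apply: alg (Ge _ Vr) (Ge _ Vp) (eH _ Voffp).
  exact: etrans (congr1 (aDG kappa gamma e) eRP) (aDG_linear gamma 1 Ve Vr Vp).
have aHX : aH kappa e e <= t * X.
  have := aDG_coercive gamma_gt0 inv Ve.
  by rewrite -ler_pdivlMl.
have Xle : X <= t * \sum_i (N1 i ^+ 2 * (lambda1 i (l1 i))^-1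
          + N2 i ^+ 2 * (lambda2 i (l2 i))^-1).
  have : X <= t / 2 * \sum_i (N1 i ^+ 2 * (lambda1 i (l1 i))^-1
          + N2 i ^+ 2 * (lambda2 i (l2 i))^-1) + aH kappa e e / (2 * t).
    rewrite Xres mulr_sumr /aH mulr_suml -big_split/=; apply: ler_sum => i _.
    by have [_ _ _] := hp i; apply: le_trans; exact: ler_norm.
  have : aH kappa e e / (2 * t) <= X / 2.
    by rewrite ler_pdivrMr ?mulr_gt0 //; move: aHX; lra.
  lra.
have X0 : 0 <= X.
  have aH0 : 0 <= aH kappa e e.
    by apply: sumr_ge0 => i _; exact: (si_ge0 (aK_semi_inner i) (Ve i)).
  by have := le_trans aH0 aHX; rewrite pmulr_rge0.
by rewrite /energy_norm sqr_sqrtr.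
Qed.

End Blocks.

Theorem theorem4p1 (R : realType) (gamma Cinv : R)
  (gamma_gt0 : 0 < gamma) (Cinv_gt0 : 0 < Cinv)
  (gamma_large : Cinv ^+ 2 < gamma) :
  exists Cerr : R, 0 < Cerr /\
  forall (M : mesh R) (kappa f : R * R -> R)
    (m1 m2 l1 l2 : 'I_(nblk M) -> nat)
    (phi xi : 'I_(nblk M) -> nat -> R * R -> R)
    (lambda1 lambda2 : 'I_(nblk M) -> nat -> R)
    (uh uH : dgfun M),
  is_mesh M ->
  measurable_fun (domain M) kappa ->
  (forall x, domain M x -> 1 <= kappa x) ->
  (exists B : R, forall x, domain M x -> kappa x <= B) ->
  measurable_fun (domain M) f ->
  (\int[lebesgue_measure \x lebesgue_measure]_(x in domain M)
     (f x ^+ 2)%:E < +oo)%E ->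
  inverse_inequality M kappa Cinv ->
  (forall i, eigenpairs kappa i (V1snap kappa i) (b1 kappa i)
               (m1 i) (phi i) (lambda1 i)) ->
  (forall i, eigenpairs kappa i (V2snap i) (b2 kappa i)
               (m2 i) (xi i) (lambda2 i)) ->
  (forall i, (l1 i < m1 i)%N /\ 0 < lambda1 i (l1 i)) ->
  (forall i, (l2 i < m2 i)%N /\ 0 < lambda2 i (l2 i)) ->
  VDG uh ->
  Voff l1 l2 phi xi uH ->
  (forall v, VDG v -> aDG kappa gamma uh v = load f v) ->
  (forall v, Voff l1 l2 phi xi v -> aDG kappa gamma uH v = load f v) ->
  energy_norm kappa gamma (fun i x => uh i x - uH i x) ^+ 2 <=
    Cerr * \sum_(i < nblk M)
      (residual_norm kappa gamma f uH i (V1snap kappa i) (b1 kappa i) ^+ 2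
         * (lambda1 i (l1 i))^-1
       + residual_norm kappa gamma f uH i (V2snap i) (b2 kappa i) ^+ 2
         * (lambda2 i (l2 i))^-1).
Proof.
exists (1 - Cinv ^+ 2 / gamma)^-1; split.
  by rewrite invr_gt0 subr_gt0 ltr_pdivrMr // mul1r.
move=> M kappa f m1 m2 l1 l2 phi xi lambda1 lambda2 uh uH hM mk k1 kB mf f2.
exact: (energy_error_bound hM mk k1 kB mf f2 gamma_gt0 gamma_large).
Qed.
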